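(* Let $N$ be a simply connected, 2-step nilpotent Lie group with Lie algebra $\mathfrak{n}$, center $Z$ and lattice $\Gamma$, equipped with a left-invariant pseudoriemannian metric tensor $\langle\,,\rangle$. Let $p_B:\Gamma\backslash N\to T_B$ be the (generalized) pseudoriemannian submersion described in the context. Then the fibers $T_F$ of $p_B$, with the geometry induced from $\Gamma\backslash N$, are isometric to $T_{\mathfrak z}=\mathfrak z/(\log\Gamma\cap\mathfrak z)$.
   Context: 2-step nilpotent means nonabelian with $[\mathfrak n,\mathfrak n]\subseteq\mathfrak z$, where $\mathfrak z$ is the center of $\mathfrak n$. $\langle\,,\rangle$ denotes both a nondegenerate symmetric bilinear form on $\mathfrak n$ (not necessarily positive definite) and the induced left-invariant metric tensor on $N$; $\mathfrak z$ may be a degenerate subspace. A lattice is a discrete subgroup $\Gamma$ such that $\Gamma\backslash N$ is compact; $\Gamma\backslash N$ carries the metric induced from $N$. $\log:N\to\mathfrak n$ is the inverse of the diffeomorphism $\exp$. Decomposition: let $\mathfrak U=\mathfrak z\cap\mathfrak z^\perp$ be the null (degenerate) part of $\mathfrak z$. Choose a null subspace $\mathfrak V$ complementary to $\mathfrak U$ in the sense of a Witt decomposition (so $\langle\,,\rangle$ pairs $\mathfrak U$ and $\mathfrak V$ dually), let $\mathfrak Z$ be the portion of $\mathfrak z$ in $\mathfrak U^\perp\cap\mathfrak V^\perp$ and $\mathfrak E$ its orthocomplement in $\mathfrak U^\perp\cap\mathfrak V^\perp$. Then $\mathfrak n=\mathfrak z\oplus\mathfrak v$ with $\mathfrak z=\mathfrak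 U\oplus\mathfrak Z$, $\mathfrak v=\mathfrak V\oplus\mathfrak E$. Let $\pi:\mathfrak n\to\mathfrak v$ be the projection. $T_{\mathfrak z}=\mathfrak z/(\log\Gamma\cap\mathfrak z)$ is a torus with the flat (possibly degenerate) metric tensor induced by the restriction of $\langle\,,\rangle$ to $\mathfrak z$ (here $\log\Gamma\cap\mathfrak z$ is a vector lattice in $\mathfrak z$). With $m=\dim\mathfrak z$ and $T^m=(\Gamma\cap Z)\backslash Z$, the group $T^m$ acts on $\Gamma\backslash N$ by $[z]\cdot\Gamma n=\Gamma zn$, making $\Gamma\backslash N$ a principal $T^m$-bundle over a torus $T_B$ of dimension $\dim\mathfrak v$, with projection $p_B:\Gamma\backslash N\to T_B$. The fibers of $p_B$ are thus the $T^m$-orbits; $T_F$ denotes the fiber with the (possibly degenerate) metric structure from its closed embedding in $\Gamma\backslash N$. The base $T_B$ is given a (possibly degenerate) geometry by requiring that $p_{B*}$ be an isometry from the subspace $\mathfrak v_\eta(\Gamma\backslash N)$ (of the splitting $T(\Gamma\backslash N)=\mathfrak z(\Gamma\backslash N)\oplus\mathfrak v(\Gamma\backslash N)$ induced by $\mathfrak n=\mathfrak z\oplus\mathfrak v$) onto the tangent space of $T_B$ at $p_B(\eta)$ for each $\eta$, and by the connection $\nabla^{T_B}_{p_{B*}x}p_{B*}y=p_{B*}(\pi\nabla_xy)$ for $x,y\in\mathfrak v$; this is the generalized sense in which $p_B$ is a pseudoriemannian submersion. *)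

(* Defs.v *)
From HB Require Import structures.
From mathcomp Require Import all_boot all_order all_algebra.
From mathcomp Require Import all_classical all_reals all_analysis.
Set Implicit Arguments. Unset Strict Implicit. Unset Printing Implicit Defensive.
Import Order.TTheory GRing.Theory Num.Theory.
Import numFieldNormedType.Exports.
Local Open Scope classical_set_scope.
Local Open Scope ring_scope.

(* [U] is meant to be open. *)
Fixpoint Ck (R : realType) (V W : normedModType R) (k : nat) (U : set V)
    (f : V -> W) : Prop :=
  match k with
  | 0 => forall x, U x -> {for x, continuous f}
  | k'.+1 => (forall x, U x -> differentiable f x) /\
             (forall v, Ck k' U ('D_v f))
  end.

Definition smooth_on (R : realType) (V W : normedModType R) (U : set V)
  (f : V -> W) : Prop := forall k, Ck k U f.

(* A local parametrization (inverse of a chart). Only its values on the open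
   set [pdom] matter. *)
Record lparam (R : realType) (n : nat) (M : Type) := LParam {
  pdom : set 'rV[R]_n;
  pmap :> 'rV[R]_n -> M }.

Definition is_lparam (R : realType) (n : nat) (M : topologicalType)
  (phi : lparam R n M) : Prop :=
  [/\ open (pdom phi),
      forall x, pdom phi x -> {for x, continuous phi},
      forall x y, pdom phi x -> pdom phi y -> phi x = phi y -> x = y &
      forall U, open U -> U `<=` pdom phi -> open (phi @` U)].

(* Near [x], the smooth map [h] is [psi^-1 \o f \o phi]. *)
Definition represents (R : realType) (m n : nat) (M M' : Type)
    (phi : lparam R m M) (psi : lparam R n M') (f : M -> M')
    (x : 'rV[R]_m) (h : 'rV[R]_m -> 'rV[R]_n) : Prop :=
  exists U, [/\ open U, U x, U `<=` pdom phi, smooth_on U h &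
    forall y, U y -> pdom psi (h y) /\ psi (h y) = f (phi y)].

Record manifold (R : realType) (n : nat) := Manifold {
  mcar :> topologicalType;
  atlas : set (lparam R n mcar);
  mfd_hausdorff : hausdorff_space mcar;
  mfd_second_countable : @second_countable mcar;
  atlas_lparam : forall phi, atlas phi -> is_lparam phi;
  atlas_cover : forall a, exists2 phi, atlas phi & (phi @` pdom phi) a;
  atlas_compat : forall phi psi, atlas phi -> atlas psi ->
    forall x, pdom phi x -> (psi @` pdom psi) (phi x) ->
    exists h, represents phi psi id x h }.

Definition smooth_in (R : realType) (m n : nat) (M : manifold R m)
    (M' : manifold R n) (A : set M) (f : M -> M') : Prop :=
  forall phi psi, atlas phi -> atlas psi ->
  forall x, pdom phi x -> A (phi x) -> (psi @` pdom psi) (f (phi x)) ->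
  exists h, represents phi psi f x h.

Definition smooth (R : realType) (m n : nat) (M : manifold R m)
  (M' : manifold R n) (f : M -> M') : Prop := smooth_in setT f.

Definition smooth2 (R : realType) (n : nat) (M : manifold R n)
    (f : M -> M -> M) : Prop :=
  forall phi1 phi2 psi : lparam R n M, atlas phi1 -> atlas phi2 -> atlas psi ->
  forall x1 x2, pdom phi1 x1 -> pdom phi2 x2 ->
  (psi @` pdom psi) (f (phi1 x1) (phi2 x2)) ->
  exists (h : 'rV[R]_n * 'rV[R]_n -> 'rV[R]_n) W,
    [/\ open W, W (x1, x2), smooth_on W h &
      forall w, W w -> [/\ pdom phi1 w.1, pdom phi2 w.2, pdom psi (h w) &
        psi (h w) = f (phi1 w.1) (phi2 w.2)]].

Definition local_diffeo (R : realType) (n : nat) (M M' : manifold R n)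
    (f : M -> M') : Prop :=
  forall x, exists (U : set M) (s : M' -> M),
    [/\ open U, U x, smooth_in U f &
     [/\ open (f @` U), smooth_in (f @` U) s &
       forall y, U y -> s (f y) = y]].

Definition immersion (R : realType) (m n : nat) (M : manifold R m)
    (M' : manifold R n) (f : M -> M') : Prop :=
  smooth f /\
  forall phi psi x h, atlas phi -> atlas psi -> pdom phi x ->
    represents phi psi f x h ->
    forall u, 'D_u h x = 0 -> u = 0.

Definition embedding (R : realType) (m n : nat) (M : manifold R m)
    (M' : manifold R n) (f : M -> M') : Prop :=
  [/\ immersion f, injective f &
    forall U : set M, open U ->
      exists2 V : set M', open V & f @` U = V `&` range f].

Definition idparam (R : realType) (n : nat) : lparam R n 'rV[R]_n :=
  LParam setT id.

Lemma second_countable_rV (R : realType) (n : nat) :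
  @second_countable 'rV[R]_n.
Proof.
pose c (w : 'rV[rat]_n) : 'rV[R]_n := \row_j ratr (w 0 j).
pose f (p : 'rV[rat]_n * nat) : set 'rV[R]_n :=
  interior (ball (c p.1) (p.2.+1%:R^-1 : R)).
exists (range f); first exact: sub_countable (card_image_le _ _) (countableP _).
split; first by move=> ? [? _ <-]; exact: open_interior.
move=> x V /nbhs_ballP [] _/posnumP[eps] ballsubV.
have [//|N] := @ltr_add_invr R 0 (eps%:num/2) _; rewrite add0r => deleps.
have dlt : (0 : R) < N.+1%:R^-1 by rewrite invr_gt0.
have d2 : (0 : R) < N.+1%:R^-1 / 2 by rewrite divr_gt0.
have wP (j : 'I_n) : exists q : rat, `|x 0 j - ratr q| < N.+1%:R^-1 / 2 :> R.
  have [|q] := @rat_in_itvoo R (x 0 j) (x 0 j + N.+1%:R^-1 / 2).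
    by rewrite ltrDl.
  rewrite in_itv/= => /andP[h1 h2]; exists q.
  by rewrite distrC gtr0_norm ?subr_gt0// ltrBlDl.
pose w : 'rV[rat]_n := \row_j projT1 (cid (wP j)).
have xw : ball (c w) (N.+1%:R^-1 / 2) x.
  apply/ball_sym; split => // i j; rewrite /ball/= !mxE (ord1 i).
  exact: projT2 (cid (wP j)).
have le2 : N.+1%:R^-1 / 2 + N.+1%:R^-1 / 2 = N.+1%:R^-1 :> R by rewrite -splitr.
exists (f (w, N)).
  split; first by exists (w, N).
  apply/nbhs_ballP; exists (N.+1%:R^-1 / 2) => //= y xy.
  by rewrite -le2; apply: ball_triangle xy.
apply: (subset_trans _ ballsubV) => y /interior_subset /= wy.
rewrite [_%:num]splitr; apply: (@ball_triangle _ _ (c w)).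
  apply: (le_ball _ (ball_sym xw)); apply/ltW/(le_lt_trans _ deleps).
  by rewrite -[leRHS]le2 lerDl ltW.
exact: (le_ball (ltW deleps)).
Qed.

Lemma smooth_on_cst (R : realType) (V W : normedModType R) (U : set V) (a : W) :
  smooth_on U (cst a).
Proof.
move=> k; elim: k a => [a x _|k IH a] /=; first exact: cst_continuous.
split=> [x _|v]; first exact: differentiable_cst.
suff -> : 'D_v (cst a) = cst (0 : W) :> (V -> W) by exact: IH.
by apply/funext => x; exact: derive_cst.
Qed.

Lemma smooth_on_id (R : realType) (V : normedModType R) (U : set V) :
  smooth_on U (@id V).
Proof.
case=> [x _|k] /=; first exact: (@cvg_id _ (nbhs x)).
split=> [x _|v]; first exact: ex_diff.
suff -> : 'D_v (@id V) = cst v :> (V -> V) by exact: smooth_on_cst.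
by apply/funext => x; exact: derive_id.
Qed.

Lemma is_lparam_idparam (R : realType) (n : nat) : is_lparam (@idparam R n).
Proof.
split=> [|x _|//|U oU _]; first exact: openT.
- exact: (@cvg_id _ (nbhs x)).
- by rewrite image_id.
Qed.

Definition euclid (R : realType) (n : nat) : manifold R n.
Proof.
refine (@Manifold R n 'rV[R]_n [set @idparam R n] _ _ _ _ _).
- exact: norm_hausdorff.
- exact: second_countable_rV.
- by move=> _ ->; exact: is_lparam_idparam.
- by move=> a; exists (@idparam R n) => //; exists a.
- move=> _ _ -> -> x _ _; exists id, setT; split => //; first exact: openT.
  exact: smooth_on_id.
Defined.

Section geometry.
Variable R : realType.

Definition form (n : nat) (G : 'M[R]_n) (u v : 'rV[R]_n) : R :=
  (u *m G *m v^T) 0 0.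

(* Metric tensor, possibly degenerate: [gcoef phi x] is its matrix at [phi x]
   in the coordinates of [phi]. *)
Record metric (n : nat) (M : manifold R n) := Metric {
  gcoef :> lparam R n M -> 'rV[R]_n -> 'M[R]_n;
  metric_sym : forall phi x, atlas phi -> pdom phi x ->
    (gcoef phi x)^T = gcoef phi x;
  metric_smooth : forall phi, atlas phi -> smooth_on (pdom phi) (gcoef phi);
  metric_tensorial : forall phi psi x h, atlas phi -> atlas psi ->
    pdom phi x -> represents phi psi id x h ->
    forall u v, form (gcoef phi x) u v =
                form (gcoef psi (h x)) ('D_u h x) ('D_v h x) }.

Definition nondegenerate_metric (n : nat) (M : manifold R n) (g : metric M) : Prop :=
  forall phi x, atlas phi -> pdom phi x -> g phi x \in unitmx.

(* [f^* g' = g] *)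
Definition preserves (m n : nat) (M : manifold R m) (M' : manifold R n)
    (g : lparam R m M -> 'rV[R]_m -> 'M[R]_m)
    (g' : lparam R n M' -> 'rV[R]_n -> 'M[R]_n) (f : M -> M') : Prop :=
  forall phi psi x h, atlas phi -> atlas psi -> pdom phi x ->
    represents phi psi f x h ->
    forall u v, form (g phi x) u v =
                form (g' psi (h x)) ('D_u h x) ('D_v h x).

Definition flat (n : nat) (G : 'M[R]_n) :
  lparam R n (euclid R n) -> 'rV[R]_n -> 'M[R]_n := fun _ _ => G.

(* [phi] is an isometry of [M] onto the subset [S] of [M'], [S] being an
   embedded submanifold with the metric induced by [g']. *)
Definition isometric_to_submanifold (m n : nat) (M : manifold R m)
    (M' : manifold R n) (g : metric M) (g' : metric M') (S : set M') : Prop :=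
  exists phi : M -> M', [/\ embedding phi, range phi = S & preserves g g' phi].

(* [conn psi x] is the bilinear map (X, Y) |-> nabla_X Y - D_X Y
   in the coordinates of [psi]. *)
Record connection (n : nat) (M : manifold R n) := Connection {
  conn :> lparam R n M -> 'rV[R]_n -> 'rV[R]_n -> 'rV[R]_n -> 'rV[R]_n;
  conn_linl : forall phi x v, atlas phi -> pdom phi x ->
    linear (fun u => conn phi x u v);
  conn_linr : forall phi x u, atlas phi -> pdom phi x ->
    linear (conn phi x u);
  conn_smooth : forall phi u v, atlas phi ->
    smooth_on (pdom phi) (fun x => conn phi x u v);
  conn_change : forall phi psi x h, atlas phi -> atlas psi ->
    pdom phi x -> represents phi psi id x h ->
    forall u v, 'D_(conn phi x u v) h x =
      'D_u ('D_v h) x + conn psi (h x) ('D_u h x) ('D_v h x) }.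

Definition simply_connected (M : topologicalType) : Prop :=
  (forall a b : M, exists c : R -> M,
     [/\ {within `[0, 1], continuous c}, c 0 = a & c 1 = b]) /\
  (forall c : R -> M, {within `[0, 1], continuous c} -> c 0 = c 1 ->
     exists H : R * R -> M,
       [/\ {within `[0, 1] `*` `[0, 1], continuous H},
           (forall t, 0 <= t <= 1 -> H (0, t) = c t /\ H (1, t) = c 0) &
           (forall s, 0 <= s <= 1 -> H (s, 0) = c 0 /\ H (s, 1) = c 0)]).

Record lieGroup (n : nat) := LieGroup {
  lmfd :> manifold R n;
  gone : lmfd;
  gmul : lmfd -> lmfd -> lmfd;
  ginv : lmfd -> lmfd;
  gmulA : associative gmul;
  gmul1 : left_id gone gmul;
  gmulV : left_inverse gone ginv gmul;
  gmul_smooth : smooth2 gmul;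
  ginv_smooth : smooth ginv }.

Definition center (n : nat) (N : lieGroup n) : set N :=
  [set c | forall a, gmul c a = gmul a c].

Definition subgroup (n : nat) (N : lieGroup n) (Gam : set N) : Prop :=
  [/\ Gam (gone N), (forall a b, Gam a -> Gam b -> Gam (gmul a b)) &
      (forall a, Gam a -> Gam (ginv a))].

Definition discrete_in (T : topologicalType) (A : set T) : Prop :=
  forall a, A a -> exists2 U : set T, open U & U `&` A = [set a].

(* [p] presents [M] as the manifold Gam \ N of cosets Gam a *)
Definition coset_space (n : nat) (N : lieGroup n) (Gam : set N)
    (M : manifold R n) (p : N -> M) : Prop :=
  [/\ set_surj setT setT p, local_diffeo p &
      forall a b, p a = p b <-> exists2 c, Gam c & b = gmul c a].

Definition lattice (n : nat) (N : lieGroup n) (Gam : set N)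
    (M : manifold R n) (p : N -> M) : Prop :=
  [/\ subgroup Gam, discrete_in Gam, coset_space Gam p & compact [set: M]].

Section lie_algebra.
Variable n : nat.
Implicit Types (N : lieGroup n) (br : 'rV[R]_n -> 'rV[R]_n -> 'rV[R]_n).

Definition is_lie_bracket br : Prop :=
  [/\ (forall x, linear (br x)), (forall x, br x x = 0) &
      (forall x y z, br x (br y z) + br y (br z x) + br z (br x y) = 0)].

(* The left-invariant vector field with value [x] at the identity,
   in the global coordinates [log]. *)
Definition left_field N (exp : 'rV[R]_n -> N) (log : N -> 'rV[R]_n)
    (x a : 'rV[R]_n) : 'rV[R]_n :=
  'D_x (fun w => log (gmul (exp a) (exp w))) 0.

(* ('rV[R]_n, br) is the Lie algebra of [N], with exponential map [exp], a
   diffeomorphism whose differential at 0 identifies 'rV[R]_n with the tangent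
   space of [N] at the identity.  The last clause says that [br] is the bracket
   [X, Y] = D_X Y - D_Y X of left-invariant fields, evaluated at the
   identity. *)
Definition lie_algebra_of N br (exp : 'rV[R]_n -> N) (log : N -> 'rV[R]_n)
    : Prop :=
  [/\ is_lie_bracket br,
      (forall s t x, exp ((s + t) *: x) = gmul (exp (s *: x)) (exp (t *: x))),
      [/\ @smooth R n n (euclid R n) N exp, @smooth R n n N (euclid R n) log,
          cancel exp log & cancel log exp] &
      forall x y, br x y = 'D_x (left_field exp log y) 0 -
                           'D_y (left_field exp log x) 0].

Definition central br (x : 'rV[R]_n) : Prop := forall y, br x y = 0.

Definition two_step_nilpotent br : Prop :=
  (exists x y, br x y <> 0) /\ (forall x y, central br (br x y)).

Definition center_basis br (m : nat) (z : 'M[R]_(m, n)) : Prop :=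
  row_free z /\ forall x : 'rV[R]_n, (x <= z)%MS <-> central br x.

Definition left_invariant N (g : metric N) : Prop :=
  forall a, preserves g g (gmul a).

(* The scalar product [G] on the Lie algebra is the value of [g] at the
   identity. *)
Definition value_at_one N (exp : 'rV[R]_n -> N) (g : metric N) (G : 'M[R]_n)
    : Prop :=
  forall psi h, atlas psi -> represents (idparam R n) psi exp 0 h ->
  forall u v, form G u v = form (g psi (h 0)) ('D_u h 0) ('D_v h 0).

(* Koszul formula: [w] is nabla_x y for left-invariant fields [x], [y]. *)
Definition levi_civita (G : 'M[R]_n) br (x y w : 'rV[R]_n) : Prop :=
  forall t, 2 * form G w t =
    form G (br x y) t - form G (br x t) y - form G (br y t) x.

(* Subspaces of the Lie algebra are row spaces. *)

Definition perp (G : 'M[R]_n) (k : nat) (W : 'M[R]_(k, n)) : 'M[R]_n :=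
  kermx (G *m W^T).

Section witt.
Variables (G : 'M[R]_n) (m : nat) (z : 'M[R]_(m, n)) (V : 'M[R]_n).

Definition Upart : 'M[R]_n := (z :&: perp G z)%MS.

Definition witt_complement : Prop :=
  [/\ (V <= perp G V)%MS, (Upart :&: perp G V = 0)%MS &
      (V :&: perp G Upart = 0)%MS].

Definition UVperp : 'M[R]_n := (perp G Upart :&: perp G V)%MS.
Definition Zpart : 'M[R]_n := (z :&: UVperp)%MS.
Definition Epart : 'M[R]_n := (perp G Zpart :&: UVperp)%MS.
Definition vpart : 'M[R]_n := (V + Epart)%MS.

(* Projection onto [vpart] along the center, acting on row vectors from the
   right. *)
Definition pi_v : 'M[R]_n := proj_mx vpart <<z>>%MS.

End witt.
End lie_algebra.

Section base.
Variables (n k : nat) (N : lieGroup n) (exp : 'rV[R]_n -> N).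
Variables (M : manifold R n) (p : N -> M) (B : manifold R k) (pB : M -> B).

(* The two points of Gam \ N lie on the same orbit of (Gam :&: Z) \ Z. *)
Definition same_orbit (e e' : M) : Prop :=
  exists c a : N, [/\ center c, p a = e & p (gmul c a) = e'].

(* The subspace of the tangent space at [phi x] spanned by the fields induced
   by the left-invariant fields in the row space of [W]. *)
Definition induced_subspace (W : 'M[R]_n) (phi : lparam R n M)
    (x : 'rV[R]_n) : set 'rV[R]_n :=
  [set u | exists a h (w : 'rV[R]_n),
     [/\ represents (idparam R n) phi (fun t => p (gmul a (exp t))) 0 h,
         h 0 = x, (w <= W)%MS & u = 'D_w h 0]].

(* In the coordinates [psi] of the base, [X] is the vector field to which
   the left-invariant field [x] projects. *)
Definition projects_to (x : 'rV[R]_n) (psi : lparam R k B)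
    (X : 'rV[R]_k -> 'rV[R]_k) : Prop :=
  forall a h,
    represents (idparam R n) psi (fun t => pB (p (gmul a (exp t)))) 0 h ->
    X (h 0) = 'D_x h 0.

Definition isometric_on (W : 'M[R]_n) (gM : metric M) (gB : metric B) : Prop :=
  forall phi psi x f, atlas phi -> atlas psi -> pdom phi x ->
  represents phi psi pB x f ->
  (forall u u', induced_subspace W phi x u -> induced_subspace W phi x u' ->
     form (gM phi x) u u' = form (gB psi (f x)) ('D_u f x) ('D_u' f x)) /\
  (forall t, exists! u, induced_subspace W phi x u /\ 'D_u f x = t).

Definition connection_from (br : 'rV[R]_n -> 'rV[R]_n -> 'rV[R]_n)
    (G W pi : 'M[R]_n) (nB : connection B) : Prop :=
  forall x y w : 'rV[R]_n, (x <= W)%MS -> (y <= W)%MS -> levi_civita G br x y w ->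
  forall psi X Y Y', atlas psi -> projects_to x psi X -> projects_to y psi Y ->
  projects_to (w *m pi) psi Y' ->
  forall b, pdom psi b -> 'D_(X b) Y b + nB psi b (X b) (Y b) = Y' b.

(* [pB] is the bundle projection of Gam \ N onto the space of orbits of
   (Gam :&: Z) \ Z, a pseudoriemannian submersion in the generalized sense
   for [v] and the projection [pi] onto it. *)
Definition pseudoriemannian_submersion
    (br : 'rV[R]_n -> 'rV[R]_n -> 'rV[R]_n) (G W pi : 'M[R]_n)
    (gM : metric M) (gB : metric B) (nB : connection B) : Prop :=
  [/\ smooth pB, set_surj setT setT pB,
      (forall e e', pB e = pB e' <-> same_orbit e e'),
      isometric_on W gM gB & connection_from br G W pi nB].

End base.

(* [q] presents [T], with metric [gT], as the quotient of the space spanned by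
   the (free) rows of [z] by its intersection with [L]; the space carries the
   restriction of [G], and coordinates in the basis [z]. *)
Definition flat_quotient (m n : nat) (z : 'M[R]_(m, n)) (G : 'M[R]_n)
    (L : set 'rV[R]_n) (T : manifold R m) (gT : metric T)
    (q : 'rV[R]_m -> T) : Prop :=
  [/\ set_surj setT setT q, @local_diffeo R m (euclid R m) T q,
      (forall s t : 'rV[R]_m, q s = q t <-> L ((s - t) *m z)) &
      @preserves m m (euclid R m) T (flat (z *m G *m z^T)) gT q].

End geometry.

(* Main.v *)
Require Import Defs.
From HB Require Import structures.
From mathcomp Require Import all_boot all_order all_algebra.
From mathcomp Require Import all_classical all_reals all_analysis.
From mathcomp Require Import lra zify.
Local Open Scope classical_set_scope.
Local Open Scope ring_scope.

(** For [a] in [N] the curve [t |-> log (a exp(t x) a^-1)] commutes with integer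
    multiples of [t] and is differentiable at 0, hence is linear.  Comparing the
    derivatives of left and right translations at 0 then shows that [exp]
    carries the center [z] of the Lie algebra onto the center of [N], and that
    [exp (x + y) = exp x exp y] for central [x].  So [s |-> Gam a exp(s)]
    ([s] in [z]) induces an injection of [z / (log Gam :&: z)] into
    [Gam \ N], whose image is the orbit of [Gam a].  It is locally the
    restriction to [z] of a local diffeomorphism [x |-> Gam b exp(x)] that pulls
    the metric back to the scalar product at [x = 0], hence an isometric
    immersion.  It is open onto the orbit because [z + v] is the whole Lie
    algebra, [pB (Gam b exp (s + v))] depends only on [v], and its derivative is
    injective on [v]: near [Gam b], the fiber is contained in [Gam b exp(z)]. *)

Section torus_fibers.
Local Set Implicit Arguments.
Local Unset Strict Implicit.
Local Unset Printing Implicit Defensive.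
Import Order.TTheory GRing.Theory Num.Theory.
Import numFieldNormedType.Exports.

(** * Differential calculus *)

Section calculus.
Context {R : realType}.
Implicit Types V W X : normedModType R.

Lemma near_open (T : topologicalType) (U : set T) (P : T -> Prop) x :
  open U -> U x -> (forall y, U y -> P y) -> \near x, P x.
Proof. by move=> oU Ux UP; apply: filterS UP _; exact: open_nbhs_nbhs. Qed.

(** A function vanishing near [x] is negligible against the increment, so its differential is 0.
    Applied to [g - f], this makes differentiability a local property. *)
Lemma near0_differentiable V W (d : V -> W) x :
  (\near x, d x = 0) -> differentiable d x.
Proof.
move=> d0.
have c0 : continuous (\0 : V -> W) by move=> ?; exact: cvg_cst.
have e : d \o shift x = cst (d x) + (\0 : V -> W) +o_ (0 : V) id.
  apply/eqaddoP => _/posnumP[e].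
  have dn : \forall z \near (0:V), d (z + x) = 0.
    by move: d0; rewrite (near_shift 0 x) /= subr0.
  near=> z.
  rewrite (_ : (_ - _) z = d (z + x)); last first.
    by rewrite /= !fctE/= (nbhs_singleton d0) addr0 subr0.
  by rewrite (near dn z)// normr0 mulr_ge0.
by apply/diff_locallyP; rewrite (diff_unique c0 e).
Unshelve. all: by end_near. Qed.

Lemma near_eq_differentiable V W (f g : V -> W) x :
  (\near x, f x = g x) -> differentiable f x -> differentiable g x.
Proof.
move=> fg df; rewrite (_ : g = f + (g - f)); last by rewrite addrC subrK.
apply: differentiableD => //; apply: near0_differentiable.
by apply: filterS fg => y e; rewrite -[LHS]/(g y - f y) e subrr.
Qed.

Lemma bilinear_scale X : bilinear_for
    (GRing.Scale.Law.clone _ _ *:%R _) (GRing.Scale.Law.clone _ _ *:%R _)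
    (@GRing.scale R X : R -> X -> X).
Proof.
split=> [u'|u] a x y /=.
- by rewrite scalerDl scalerA.
- by rewrite scalerDr !scalerA mulrC.
Qed.

(** Leibniz rule: the product is the pairing of [a] and [b] followed by scaling, a continuous
    bilinear map. *)
Lemma is_diff_scale V X (a : V -> R) (b : V -> X) x :
  differentiable a x -> differentiable b x ->
  is_diff x (fun y => a y *: b y) (fun v => a x *: 'd b x v + 'd a x v *: b x).
Proof.
move=> da db.
pose sM := bilinear_isBilinear.Build R R X X _ _ (@GRing.scale R X) (bilinear_scale X).
pose s : {bilinear R -> X -> X} := HB.pack (@GRing.scale R X) sM.
have sc : continuous (fun p : R * X => s p.1 p.2).
  by move=> p; apply: (@scale_continuous _ X).
have dp : differentiable (fun y => (a y, b y)) x by exact: differentiable_pair.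
have ds := differentiable_bilin (a x, b x) sc.
apply: DiffDef.
  exact: (@differentiable_comp _ _ _ _ (fun y => (a y, b y)) _ x dp ds).
rewrite (@diff_comp _ _ _ _ (fun y => (a y, b y)) (fun p : R * X => s p.1 p.2) x dp ds).
by rewrite (diff_bilin _ sc) diff_pair.
Qed.

(** * Functions of class [Ck] *)

Lemma Ck_sub V W k (U U' : set V) (f : V -> W) :
  U' `<=` U -> Ck k U f -> Ck k U' f.
Proof.
move=> UU'; elim: k f => [f cf x Ux|k IH f [df Cf]]; first exact/cf/UU'.
by split=> [x Ux|v]; [exact/df/UU'|exact/IH/Cf].
Qed.

Lemma CkW V W k (U : set V) (f : V -> W) : Ck k.+1 U f -> Ck k U f.
Proof.
elim: k f => [f [df _] x /df|k IH f [df Cf]]; first exact: differentiable_continuous.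
by split=> // v; apply: IH; exact: Cf.
Qed.

(** [Ck] is a pointwise condition on the total functions ['D_v f], so it can be checked around one
    point at a time. *)
Lemma Ck_local V W k (U : set V) (f : V -> W) :
  (forall x, U x -> exists2 U', U' x & Ck k U' f) -> Ck k U f.
Proof.
elim: k f => [f H x /H[U' U'x]|k IH f H]; first exact.
split=> [x /H[U' U'x [df _]]|v]; first exact: df.
by apply: IH => x /H[U' U'x [_ Cf]]; exists U'; last exact: Cf.
Qed.

(** Openness turns equality on [U] into equality near each point, which passes to derivatives. An
    iterated derivative can thus be replaced by a formula valid on [U] alone. *)
Lemma Ck_eq V W k (U : set V) (f g : V -> W) : open U ->
  (forall x, U x -> f x = g x) -> Ck k U f -> Ck k U g.
Proof.
move=> oU; elim: k f g => [f g fg cf x Ux|k IH f g fg [df Cf]].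
  have fgx : \near x, f x = g x by exact: near_open Ux fg.
  have gx : g @ x --> f x by apply: cvg_trans (cf x Ux); exact: near_eq_cvg.
  by rewrite fg in gx.
split=> [x Ux|v].
  exact: (near_eq_differentiable (near_open oU Ux fg) (df x Ux)).
apply: IH (Cf v) => x Ux; exact/near_eq_derive/near_open/fg.
Qed.

Lemma CkD V W k (U : set V) (f g : V -> W) : open U ->
  Ck k U f -> Ck k U g -> Ck k U (f + g).
Proof.
move=> oU; elim: k f g => [f g cf cg x Ux|k IH f g [df Cf] [dg Cg]].
  by apply: continuousD; [exact: cf|exact: cg].
split=> [x Ux|v]; first by apply: differentiableD; [exact: df|exact: dg].
apply: (Ck_eq oU _ (IH _ _ (Cf v) (Cg v))) => x Ux.
by rewrite deriveD//; apply: diff_derivable; [exact: df|exact: dg].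
Qed.

Lemma Ck_sum V W k (U : set V) n (f : 'I_n -> V -> W) : open U ->
  (forall i, Ck k U (f i)) -> Ck k U (\sum_i f i).
Proof.
move=> oU Cf; elim/big_ind: _ => //; last by move=> *; exact: CkD.
exact: (smooth_on_cst U (0 : W)).
Qed.

Lemma CkZ V W k (U : set V) (a : V -> R) (b : V -> W) : open U ->
  Ck k U a -> Ck k U b -> Ck k U (fun x => a x *: b x).
Proof.
move=> oU; elim: k a b => [a b ca cb x Ux|k IH a b [da Ca] [db Cb]].
  by apply: cvgZ; [exact: ca|exact: cb].
have Dab x : U x -> is_diff x (fun y => a y *: b y)
    (fun v => a x *: 'd b x v + 'd a x v *: b x).
  by move=> Ux; apply: is_diff_scale; [exact: da|exact: db].
split=> [x Ux|v]; first by have := Dab x Ux.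
(* The derivative of the product also contains the factors themselves, needed here one order
   lower. *)
have Ca0 : Ck k U a by apply: CkW; split.
have Cb0 : Ck k U b by apply: CkW; split.
apply: (Ck_eq oU _ (CkD oU (IH _ _ Ca0 (Cb v)) (IH _ _ (Ca v) Cb0))) => x Ux.
have ? := Dab x Ux.
rewrite [RHS]deriveE// diff_val -[LHS]/(a x *: 'D_v b x + 'D_v a x *: b x).
by rewrite !deriveE //; [exact: da|exact: db].
Qed.

Lemma Ck_linear_comp V W X k (U : set V) (l : {linear W -> X}) (f : V -> W) :
  open U -> continuous l -> Ck k U f -> Ck k U (l \o f).
Proof.
move=> oU cl; elim: k f => [f cf x Ux|k IH f [df Cf]].
  by apply: continuous_comp; [exact: cf|exact: cl].
have dl y : differentiable l y by exact: linear_differentiable.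
split=> [x Ux|v]; first by apply: differentiable_comp; [exact: df|].
apply: (Ck_eq oU _ (IH _ (Cf v))) => x Ux; have dfx := df x Ux.
rewrite [RHS]deriveE; last exact: differentiable_comp.
by rewrite diff_comp// diff_lin//= deriveE.
Qed.

(* A normed module with finitely many continuous coordinates; this is what
   turns the chain rule into a formula with directional derivatives only. *)
Definition has_coordinates W := exists n (l : 'I_n -> {linear W -> R})
  (e : 'I_n -> W), (forall i, continuous (l i)) /\
  forall w, w = \sum_i l i w *: e i.

(** Chain rule in coordinates: ['D_v (g \o f)] is the sum of the
    [l i ('D_v f) *: ('D_(e i) g \o f)]. The induction hypothesis treats ['D_(e i) g \o f], and
    [CkZ] the products. *)
Lemma Ck_comp V W X k (U : set V) (U' : set W) (f : V -> W) (g : W -> X) :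
  has_coordinates W -> open U -> (forall x, U x -> U' (f x)) ->
  Ck k U f -> Ck k U' g -> Ck k U (g \o f).
Proof.
move=> [n [l [e [cl le]]]] oU UU'; elim: k f g UU' => [f g UU' cf cg x Ux|].
  by apply: continuous_comp; [exact: cf|exact/cg/UU'].
move=> k IH f g UU' [df Cf] [dg Cg].
have Cf0 : Ck k U f by apply: CkW; split.
split=> [x Ux|v].
  by apply: differentiable_comp; [exact: df|exact/dg/UU'].
apply: (@Ck_eq _ _ _ _ (\sum_i (fun x => l i ('D_v f x) *: 'D_(e i) g (f x)))) => //.
  move=> x Ux; have dfx := df x Ux; have dgx := dg _ (UU' x Ux).
  rewrite [RHS]deriveE; last exact: differentiable_comp.
  rewrite diff_comp//= -(deriveE v dfx) [in RHS](le ('D_v f x)) linear_sum.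
  rewrite fct_sumE; apply: eq_bigr => i _.
  by rewrite linearZ !deriveE.
apply: (@Ck_sum _ _ _ _ _ (fun i x => l i ('D_v f x) *: 'D_(e i) g (f x)) oU) => i.
apply: CkZ => //.
  exact: (Ck_linear_comp oU (cl i) (Cf v)).
exact: (IH f ('D_(e i) g) UU' Cf0 (Cg (e i))).
Qed.

Lemma smooth_on_comp V W X (U : set V) (U' : set W) (f : V -> W) (g : W -> X) :
  has_coordinates W -> open U -> (forall x, U x -> U' (f x)) ->
  smooth_on U f -> smooth_on U' g -> smooth_on U (g \o f).
Proof. by move=> ? ? fU sf sg k; exact: (Ck_comp _ _ fU). Qed.

Lemma smooth_on_linear V W (U : set V) (l : {linear V -> W}) :
  open U -> continuous l -> smooth_on U l.
Proof. by move=> oU cl k; apply: (Ck_linear_comp (f := id)) => //; exact: smooth_on_id. Qed.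

Lemma has_coordinates_rV n : has_coordinates 'rV[R]_n.
Proof.
pose l (i : 'I_n) (v : 'rV[R]_n) : R := v 0 i.
have lin i : linear (l i : 'rV[R]_n -> R) by move=> a u v; rewrite /l !mxE.
pose ll i : {linear 'rV[R]_n -> R} := HB.pack (l i) (GRing.isLinear.Build _ _ _ _ (l i) (lin i)).
exists n, ll, (fun i => delta_mx 0 i); split=> [i|w]; first exact: coord_continuous.
exact: row_sum_delta.
Qed.

(** The group law in coordinates is a function on a product; this makes [Ck_comp] available
    there. *)
Lemma has_coordinates_prod V W :
  has_coordinates V -> has_coordinates W -> has_coordinates (V * W)%type.
Proof.
move=> [n [l [e [cl le]]]] [m [l' [e' [cl' le']]]].
pose L (i : 'I_(n + m)) (p : V * W) : R :=
  match fintype.split i with inl i => l i p.1 | inr i => l' i p.2 end.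
have lin i : linear (L i : V * W -> R).
  by move=> a u v; rewrite /L; case: fintype.split => j; rewrite linearP.
pose LL i : {linear (V * W)%type -> R} := HB.pack (L i) (GRing.isLinear.Build _ _ _ _ (L i) (lin i)).
exists (n + m)%N, LL, (fun i => match fintype.split i with inl i => (e i, 0) | inr i => (0, e' i) end).
split=> [i|[v w]].
  have -> : (LL i : _ -> _) = L i by [].
  rewrite /L; case: fintype.split => j p; apply: continuous_comp;
    by [exact: cvg_fst|exact: cvg_snd|exact: cl|exact: cl'].
rewrite big_split_ord/=.
under eq_bigr do rewrite /L (unsplitK (inl _)).
under [X in _ + X]eq_bigr do rewrite /L (unsplitK (inr _)).
have sum1 k (c : 'I_k -> R) (x : 'I_k -> V) : \sum_i c i *: (x i, 0 : W) = (\sum_i c i *: x i, 0).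
  elim/big_rec2: _ => [//|i a b _ ->]; by rewrite [LHS]surjective_pairing /= scaler0 addr0.
have sum2 k (c : 'I_k -> R) (x : 'I_k -> W) : \sum_i c i *: (0 : V, x i) = (0, \sum_i c i *: x i).
  elim/big_rec2: _ => [//|i a b _ ->]; by rewrite [LHS]surjective_pairing /= scaler0 addr0.
rewrite sum1 sum2 /= -le -le'.
by rewrite [RHS]surjective_pairing /= addr0 add0r.
Qed.
Lemma derive_comp V W X (f : V -> W) (g : W -> X) x v :
  differentiable f x -> differentiable g (f x) ->
  'D_v (g \o f) x = 'D_('D_v f x) g (f x).
Proof.
move=> df dg; rewrite [LHS]deriveE; last exact: differentiable_comp.
by rewrite diff_comp//= !deriveE.
Qed.

Lemma continuous_linear_rV n W (l : {linear 'rV[R]_n -> W}) : continuous l.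
Proof.
have -> : (l : _ -> _) = \sum_i (fun u : 'rV[R]_n => u 0 i *: l (delta_mx 0 i)).
  apply/funext => u; rewrite {1}(row_sum_delta u) linear_sum fct_sumE.
  by apply: eq_bigr => i _; rewrite linearZ.
suff C0 : Ck 0 setT (\sum_i (fun u : 'rV[R]_n => u 0 i *: l (delta_mx 0 i))).
  by move=> x; exact: C0.
apply: Ck_sum => [|i x _]; first exact: openT.
exact: (@cvgZr_tmp _ _ _ (nbhs x) _ _ _ _ (@coord_continuous R 1 n 0 i x)).
Qed.

(* Stands in for the uniqueness of one-parameter subgroups with given velocity. *)
Lemma homogeneous_curve V (c : R -> V) : differentiable c 0 ->
  (forall (k : nat) s, c (k%:R * s) = k%:R *: c s) ->
  forall s, c s = s *: 'D_1 c 0.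
Proof.
move=> dc hc s.
have c0 : c 0 = 0 by have := hc 0%N 0; rewrite mul0r scale0r.
have dE h : 'd c 0 h = h *: 'D_1 c 0.
  by rewrite deriveE// -linearZ; congr ('d c 0 _); rewrite [RHS]mulr1.
apply/eqP; rewrite -subr_eq0 -normr_le0; apply/ler_addgt0Pr => e e0; rewrite add0r.
(* The error at [s] will be this constant times the norm of [s], hence at most [e]; adding 1 keeps
   the divisor positive. *)
have e1 : 0 < e / (`|s| + 1) by rewrite divr_gt0// ltr_wpDl.
have /eqaddoP/(_ _ e1)/nbhs_ballP[r /= r0 Hr] := diff_locally dc.
(* With this [k], the point [s / (k + 1)] lies within [r] of 0; homogeneity then multiplies the
   estimate there by [k + 1]. *)
have [k kr] : exists k : nat, `|s| / r < k.+1%:R.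
  by exists (Num.truncn (`|s| / r)); rewrite truncnS_gt.
have k0 : 0 < k.+1%:R :> R by [].
have := Hr (k.+1%:R^-1 * s); rewrite -ball_normE/= sub0r normrN.
rewrite -[(_ - _) _]/(c (_ + 0) - (c 0 + 'd c 0 _)) addr0 c0 add0r dE => H.
have {}H : `|c (k.+1%:R^-1 * s) - (k.+1%:R^-1 * s) *: 'D_1 c 0| <=
   e / (`|s| + 1) * `|k.+1%:R^-1 * s|.
  apply: H; rewrite normrM normfV normr_nat mulrC ltr_pdivrMr//.
  by move: kr; rewrite ltr_pdivrMr// mulrC.
have -> : c s - s *: 'D_1 c 0 = k.+1%:R *: (c (k.+1%:R^-1 * s) - (k.+1%:R^-1 * s) *: 'D_1 c 0).
  by rewrite scalerBr -hc scalerA !mulrA divff ?gt_eqF// mul1r.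
rewrite normrZ normr_nat -ler_pdivlMl//; apply: (le_trans H).
rewrite normrM normfV normr_nat mulrCA ler_pM2l ?invr_gt0//.
by rewrite mulrAC -mulrA ger_pMr// ler_pdivrMr ?ltr_wpDl// mul1r lerDl.
Qed.

Lemma derive0_cst n (c : R -> 'rV[R]_n) :
  (forall t : R, is_derive t (1 : R) c 0) -> forall t, c t = c 0.
Proof.
move=> dc t; apply/rowP => i.
apply: (is_derive_0_is_cst (f := fun t => c t 0 i)) => s.
have [dcs cs0] := dc s.
apply: DeriveDef; first by move/derivable_mxP: dcs; apply.
by have := derive_mx dcs; rewrite cs0 => /rowP/(_ i); rewrite !mxE.
Qed.

Lemma smooth_on_pair V W X (U : set V) (f : V -> W) (g : V -> X) : open U ->
  smooth_on U f -> smooth_on U g -> smooth_on U (fun x => (f x, g x)).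
Proof.
move=> oU sf sg k; move: (sf k) (sg k) => {sf sg}; elim: k f g => [|k IH] f g.
  by move=> cf cg x Ux; apply: cvg_pair; [exact: cf|exact: cg].
move=> [df Cf] [dg Cg]; split=> [x Ux|v].
  by apply: differentiable_pair; [exact: df|exact: dg].
apply: (Ck_eq oU _ (IH _ _ (Cf v) (Cg v))) => x Ux.
have dfx := df x Ux; have dgx := dg x Ux.
by rewrite [RHS]deriveE ?diff_pair ?deriveE//; exact: differentiable_pair.
Qed.

(** The Jacobian is injective on [W], so [v] in [W] is recovered linearly from ['D_v f 0] and is
    bounded by [C] times it. If [f v = f 0], then ['D_v f 0] is negligible against [v], so a small
    [v] must vanish. *)
Lemma isolated_fiber n k (W : 'M[R]_n) (f : 'rV[R]_n -> 'rV[R]_k) :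
  differentiable f 0 ->
  (forall v : 'rV_n, (v <= W)%MS -> 'D_v f 0 = 0 -> v = 0) ->
  \forall v \near (0 : 'rV[R]_n), (v <= W)%MS -> f v = f 0 -> v = 0.
Proof.
move=> df inj.
pose B := row_base W; pose J := jacobian f 0.
have /row_freeP[K BJK] : row_free (B *m J).
  rewrite -kermx_eq0; apply/eqP/row_matrixP => i; rewrite row0.
  set s := row i _.
  have sBJ : s *m (B *m J) = 0 by rewrite /s -row_mul mulmx_ker row0.
  have sB : s *m B = 0.
    apply: inj; first by rewrite -(eq_row_base W) submxMl.
    by rewrite deriveEjacobian// -mulmxA.
  by apply: (row_free_inj (row_base_free W)); rewrite sB mul0mx.
have vE v : (v <= W)%MS -> v = ('D_v f 0) *m (K *m B).
  rewrite -(eq_row_base W) => /submxP[s ->].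
  rewrite deriveEjacobian// -/J -[s *m B *m J]mulmxA -mulmxA [B *m J *m _]mulmxA.
  by rewrite BJK mul1mx.
have [C C0 lip] := linear_lipschitz (@continuous_linear_rV _ _ (mulmxr (K *m B))).
(* Half of [C^-1]: the two estimates then bound the norm of [v] by half of itself. *)
have e0 : 0 < (C *+ 2)^-1 by rewrite invr_gt0 mulrn_wgt0.
have /eqaddoP/(_ _ e0) near0 := diff_locally df.
apply: filterS near0 => v + vW fv.
rewrite -[(_ - _) v]/(f (v + 0) - (f 0 + 'd f 0 v)) addr0 fv opprD addrA subrr add0r.
rewrite normrN => Hv.
have le1 : `|v| <= C * ((C *+ 2)^-1 * `|v|).
  rewrite {1}(vE v vW); apply: (le_trans (lip _)).
  by rewrite deriveE// ler_pM2l.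
apply/eqP; rewrite -normr_eq0; apply/eqP/le_anti; rewrite normr_ge0 andbT.
move: le1; rewrite mulrA -mulr_natr invfM mulrA divff ?gt_eqF// mul1r => le1.
by move: le1; rewrite -subr_le0 -{1}(mul1r `|v|) -mulrBl pmulr_rle0 //; lra.
Qed.
End calculus.

(** * Manifolds *)

Section manifolds.
Context {R : realType}.

Lemma smooth_on_continuous (V W : normedModType R) (U : set V) (h : V -> W) x :
  smooth_on U h -> U x -> {for x, continuous h}.
Proof. by move=> sh; exact: (sh 0%N). Qed.

Lemma smooth_on_differentiable (V W : normedModType R) (U : set V) (h : V -> W) x :
  smooth_on U h -> U x -> differentiable h x.
Proof. by move=> sh; have [dh _] := sh 1%N; exact: dh. Qed.

Lemma open_setI_preimage (S T : topologicalType) (h : S -> T) U Q :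
  open U -> open Q -> (forall x, U x -> {for x, continuous h}) ->
  open (U `&` h @^-1` Q).
Proof.
move=> oU oO ch; rewrite openE => x [Ux Ohx]; apply: filterI.
  exact: open_nbhs_nbhs.
by apply: (ch x Ux); exact: open_nbhs_nbhs.
Qed.

(** * Coordinate expressions of maps *)

Section represents.
Context {m n k : nat} {L M N : Type}.
Implicit Types (phi : lparam R m L) (psi : lparam R n M) (chi : lparam R k N).

Lemma represents_at phi psi f x h : represents phi psi f x h ->
  [/\ pdom phi x, pdom psi (h x) & psi (h x) = f (phi x)].
Proof. by move=> [U [_ Ux Uphi _ hU]]; have [] := hU x Ux; split=> //; exact: Uphi. Qed.

Lemma represents_differentiable phi psi f x h :
  represents phi psi f x h -> differentiable h x.
Proof. by move=> [U [_ Ux _ sh _]]; exact: smooth_on_differentiable Ux. Qed.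

Lemma represents_near phi psi f g x h : (\forall y \near x, f (phi y) = g (phi y)) ->
  represents phi psi f x h -> represents phi psi g x h.
Proof.
move=> fg0; have : nbhs x [set y | f (phi y) = g (phi y)] by [].
rewrite nbhsE => -[Q [oO Ox] fg] [U [oU Ux Uphi sh hU]].
exists (U `&` Q); split=> //; first exact: openI.
- by move=> y [/Uphi].
- by move=> j; apply: Ck_sub (sh j) => y [].
- by move=> y [/hU[pf ->] /fg <-].
Qed.

Lemma represents_comp phi psi chi f g x h l :
  represents phi psi f x h -> represents psi chi g (h x) l ->
  represents phi chi (g \o f) x (l \o h).
Proof.
move=> [U [oU Ux Uphi sh hU]] [Q [oO Ox Opsi sl lO]].
have ch y : U y -> {for y, continuous h} by exact: smooth_on_continuous.
exists (U `&` h @^-1` Q); split=> //; first exact: open_setI_preimage.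
- by move=> y [/Uphi].
- apply: (@smooth_on_comp _ _ _ _ _ Q _ _ (has_coordinates_rV n)) => //.
  + exact: open_setI_preimage.
  + by move=> y [].
  + by move=> j; apply: Ck_sub (sh j) => y [].
- by move=> y [/hU[_ e] /lO[? /=]]; rewrite e.
Qed.
End represents.

Lemma represents_smooth m n (h : 'rV[R]_m -> 'rV[R]_n) x :
  smooth_on setT h -> represents (idparam R m) (idparam R n) h x h.
Proof. by move=> sh; exists setT; split=> //; exact: openT. Qed.

Section charts.
Context {n : nat} {M : manifold R n}.
Implicit Types (phi : lparam R n M).

Lemma chart_at (a : M) : exists phi x, [/\ atlas phi, pdom phi x & phi x = a].
Proof. by have [phi ? [x ? ?]] := atlas_cover a; exists phi, x. Qed.

Lemma represents_id phi x : atlas phi -> pdom phi x -> represents phi phi id x id.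
Proof.
move=> aphi px; have [op _ _ _] := atlas_lparam aphi.
by exists (pdom phi); split=> //; exact: smooth_on_id.
Qed.

Lemma chart_cvg phi x : atlas phi -> pdom phi x -> {for x, continuous phi}.
Proof. by move=> /atlas_lparam[_ cphi _ _]; exact: cphi. Qed.

Lemma chart_nbhs phi x (P : set 'rV[R]_n) : atlas phi -> pdom phi x ->
  nbhs x P -> nbhs (phi x) (phi @` P).
Proof.
move=> aphi px; have [op _ _ oim] := atlas_lparam aphi.
rewrite (nbhsE x) => -[Q [oO Ox] OP].
apply: (@filterS _ _ _ (phi @` (Q `&` pdom phi))).
  by move=> _ [y [/OP Py _] <-]; exists y.
apply: open_nbhs_nbhs; split; last by exists x.
by apply: oim; [exact: openI|move=> y []].
Qed.
End charts.

Section uniqueness.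
Context {m n : nat} {L : Type} {N : manifold R n}.
Implicit Types (phi : lparam R m L) (psi : lparam R n N).

(** Injectivity of [psi] on its domain leaves one choice for the coordinates of [f (phi y)]. *)
Lemma represents_unique phi psi f x h h' : atlas psi ->
  represents phi psi f x h -> represents phi psi f x h' -> \near x, h x = h' x.
Proof.
move=> apsi [U [oU Ux _ _ hU]] [U' [oU' Ux' _ _ hU']].
have [_ _ inj _] := atlas_lparam apsi.
apply: (@near_open _ (U `&` U')) => [|//|y [/hU[? e] /hU'[? e']]]; first exact: openI.
by apply: inj => //; rewrite e e'.
Qed.

(** The geometric conditions quantify over all representatives; this lets each be computed with a
    convenient composite. *)
Lemma represents_derive phi psi f x h h' : atlas psi ->
  represents phi psi f x h -> represents phi psi f x h' ->
  h x = h' x /\ forall u, 'D_u h x = 'D_u h' x.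
Proof.
move=> apsi rh rh'; have hh' := represents_unique apsi rh rh'.
by split=> [|u]; [exact: nbhs_singleton hh'|exact: near_eq_derive].
Qed.
End uniqueness.

Section smooth_maps.
Context {m n : nat} {M : manifold R m} {N : manifold R n}.
Implicit Types (phi : lparam R m M) (psi : lparam R n N).

Lemma smooth_in_sub (A B : set M) (f : M -> N) :
  A `<=` B -> smooth_in B f -> smooth_in A f.
Proof. by move=> AB sf phi psi aphi apsi x px /AB; exact: sf. Qed.

(** Near [a], [f] is [psi \o h] read through [phi], and [phi] carries neighborhoods to neighborhoods
    because charts are open maps. *)
Lemma smooth_in_continuous (A : set M) (f : M -> N) a :
  smooth_in A f -> A a -> {for a, continuous f}.
Proof.
move=> sf Aa; have [phi [x [aphi px e]]] := chart_at a.
rewrite -e in Aa *.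
have [psi apsi psiy] := atlas_cover (f (phi x)).
have [h [U [oU Ux Uphi sh hU]]] := sf _ _ aphi apsi x px Aa psiy.
move=> Q nO.
have : nbhs x (U `&` [set y | Q (psi (h y))]).
  apply: filterI; first exact: open_nbhs_nbhs.
  have [phx fx] := hU x Ux.
  have ch := smooth_on_continuous sh Ux.
  have cc : {for x, continuous (psi \o h)} by apply: continuous_comp => //; exact: chart_cvg.
  by apply: (cc Q); rewrite /= fx.
move=> /(chart_nbhs aphi px); apply: filterS => _ [y [Uy Oy] <-].
by have [_ fy] := hU y Uy; rewrite /preimage/= -fy.
Qed.

Lemma smooth_continuous (f : M -> N) : smooth f -> continuous f.
Proof. by move=> sf a; exact: smooth_in_continuous sf I. Qed.

Lemma smooth_represents (f : M -> N) phi x : smooth f -> atlas phi -> pdom phi x ->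
  exists psi h, atlas psi /\ represents phi psi f x h.
Proof.
move=> sf aphi px; have [psi apsi psiy] := atlas_cover (f (phi x)).
by have [h rh] := sf _ _ aphi apsi x px I psiy; exists psi, h.
Qed.
End smooth_maps.

Lemma smooth_in_comp l m n (L : manifold R l) (M : manifold R m) (N : manifold R n)
    (A : set L) (B : set M) (f : L -> M) (g : M -> N) :
  (forall a, A a -> B (f a)) -> smooth_in A f -> smooth_in B g ->
  smooth_in A (g \o f).
Proof.
move=> AB sf sg phi chi aphi achi x px Ax cgf.
have [psi apsi psiy] := atlas_cover (f (phi x)).
have [h rh] := sf _ _ aphi apsi x px Ax psiy.
have [_ phx e] := represents_at rh.
have [] := sg _ _ apsi achi (h x) phx; rewrite ?e//; first exact: AB.
by move=> k rk; exists (k \o h); exact: represents_comp rk.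
Qed.

Lemma smooth_comp l m n (L : manifold R l) (M : manifold R m) (N : manifold R n)
    (f : L -> M) (g : M -> N) : smooth f -> smooth g -> smooth (g \o f).
Proof. exact: smooth_in_comp. Qed.

(** * Local diffeomorphisms and their derivatives *)

Section local_diffeo.
Context {n : nat}.
Implicit Types L M N : manifold R n.

Lemma local_diffeo_smooth M N (f : M -> N) : local_diffeo f -> smooth f.
Proof.
move=> lf phi psi aphi apsi x px _ psiy.
by have [U [s [_ Ux sf _]]] := lf (phi x); exact: (sf _ _ aphi apsi).
Qed.

(** Near [f u], the image contains the points of the image of [U0] that the continuous local inverse
    [s] sends into [U]. *)
Lemma local_diffeo_open M N (f : M -> N) (U : set M) :
  local_diffeo f -> open U -> open (f @` U).
Proof.
move=> lf oU; rewrite openE => _ [u Uu <-].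
have [U0 [s [oU0 U0u _ [ofU0 ss sK]]]] := lf u.
apply: (@filterS _ _ _ (f @` U0 `&` s @^-1` U)).
  by move=> _ [[w U0w <-]]; rewrite /preimage/= sK// => Uw; exists w.
apply: open_nbhs_nbhs; split.
  by apply: open_setI_preimage => // y; exact: smooth_in_continuous.
by split; [exists u|rewrite /preimage/= sK].
Qed.

Lemma local_diffeo_comp L M N (f : L -> M) (g : M -> N) :
  local_diffeo f -> local_diffeo g -> local_diffeo (g \o f).
Proof.
move=> lf lg x.
have [U [s [oU Ux sf [ofU ss sK]]]] := lf x.
have [Q [t [oO Ofx sg [ogO st tK]]]] := lg (f x).
have oW : open (U `&` f @^-1` Q).
  by apply: open_setI_preimage => // y; exact: smooth_in_continuous.
exists (U `&` f @^-1` Q), (s \o t); split=> //.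
  apply: (smooth_in_comp (B := Q)) => //; first by move=> y [].
  by apply: smooth_in_sub sf => y [].
split.
- by rewrite -image_comp; do 2 apply: local_diffeo_open => //.
- apply: (smooth_in_comp (B := f @` U)) => //.
    by move=> _ [y [Uy Ofy] <-]; rewrite /= tK//; exists y.
  by apply: smooth_in_sub st => _ [y [_ Ofy] <-]; exists (f y).
- by move=> y [Uy Ofy] /=; rewrite tK// sK.
Qed.

Lemma diffeo_local_diffeo M N (f : M -> N) (s : N -> M) :
  smooth f -> smooth s -> cancel f s -> cancel s f -> local_diffeo f.
Proof.
move=> sf ss fK sK x; exists setT, s; split=> //; first exact: openT.
suff -> : f @` setT = setT by split=> //; exact: openT.
by apply/seteqP; split=> // y _; exists (s y).
Qed.

(** Coordinate expressions [h] of [f] and [k] of a local inverse compose to expressions of the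
    identity in both orders, so their derivatives are mutually inverse. *)
Lemma local_diffeo_derive M N (f : M -> N) (phi : lparam R n M)
    (psi : lparam R n N) x h :
  local_diffeo f -> atlas phi -> atlas psi -> represents phi psi f x h ->
  (forall u, 'D_u h x = 0 -> u = 0) /\ (forall w, exists u, 'D_u h x = w).
Proof.
move=> lf aphi apsi rh; have [px phx e] := represents_at rh.
have [U [s [oU Ux sf [ofU ss sK]]]] := lf (phi x).
have [||k rk] := ss psi phi apsi aphi (h x) phx.
- by rewrite e; exists (phi x).
- by rewrite e sK//; exists x.
have dh := represents_differentiable rh.
have dk := represents_differentiable rk.
have rid : represents phi phi id x (k \o h).
  apply: represents_near (represents_comp rh rk).
  have sfK : nbhs (phi x) [set y | s (f y) = y] by exact: near_open sK.
  exact: (chart_cvg aphi px sfK).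
have [khx Dkh] := represents_derive aphi rid (represents_id aphi px).
split=> [u Du0|w].
  by have := Dkh u; rewrite derive_comp// Du0 derive0 derive_id.
(* Rebased at [k (h x)], [rh] can be composed after [rk]. *)
rewrite /= in khx; rewrite -[in X in represents _ _ _ X h]khx in rh.
have rid' : represents psi psi id (h x) (h \o k).
  apply: represents_near (represents_comp rk rh).
  have fsK : nbhs (psi (h x)) [set y | f (s y) = y].
    rewrite e; apply: (near_open ofU); first by exists (phi x).
    by move=> _ [y Uy <-] /=; rewrite sK.
  exact: (chart_cvg apsi phx fsK).
have [_ /(_ w)] := represents_derive apsi rid' (represents_id apsi phx).
by rewrite derive_comp ?khx// derive_id => <-; eexists.
Qed.
End local_diffeo.

Section lie_group_maps.
Context {n : nat} (N : lieGroup R n).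

(** Joint smoothness is restricted to the slice through the coordinates [x0] of [a]. *)
Lemma gmul_smooth_r (a : N) : smooth (gmul a).
Proof.
move=> phi psi aphi apsi x px _ psiy.
have [chi [x0 [achi cx0 e]]] := chart_at a.
rewrite -e in psiy.
have [h [W [oW Wx sh hW]]] := gmul_smooth achi aphi apsi cx0 px psiy.
have sp : smooth_on setT (fun y : 'rV[R]_n => (x0, y)).
  apply: smooth_on_pair; [exact: openT|exact: smooth_on_cst|exact: smooth_on_id].
have oU : open [set y | W (x0, y)].
  rewrite -[[set _ | _]]setTI.
  apply: (open_setI_preimage (h := fun y : 'rV[R]_n => (x0, y))) => //; first exact: openT.
  by move=> y _; exact: smooth_on_continuous sp I.
exists (fun y => h (x0, y)), [set y | W (x0, y)]; split=> //.
- by move=> y /hW[].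
- apply: (@smooth_on_comp _ _ _ _ _ W (fun y : 'rV[R]_n => (x0, y)) h) => //.
    exact: has_coordinates_prod (has_coordinates_rV n) (has_coordinates_rV n).
  by move=> j; apply: Ck_sub (sp j).
- by move=> y /hW[_ _ pf ->]; rewrite e.
Qed.
End lie_group_maps.
End manifolds.

(** * Exponential coordinates on a Lie group *)

Section lie.
Context {R : realType}.

(** Reduces a directional derivative at 0 to one real variable, so that knowing [f] along a line
    suffices to compute it. *)
Lemma derive_line (V W : normedModType R) (f : V -> W) (y : V) :
  differentiable f 0 -> 'D_y f 0 = 'D_(1 : R) (fun t : R => f (t *: y)) 0.
Proof.
move=> df; have := is_diff_scalel (0 : R) y => dl.
have df' : differentiable f ((0 : R) *: y) by rewrite scale0r.
rewrite (derive_comp (f := fun t : R => t *: y) (g := f) _ _ df')//.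
by rewrite scale0r (deriveE (f := fun t : R => t *: y))// diff_val scale1r.
Qed.

Lemma alternating_anti (U V : zmodType) (b : U -> U -> V) :
  (forall x y z, b (x + y) z = b x z + b y z) ->
  (forall z x y, b z (x + y) = b z x + b z y) -> (forall x, b x x = 0) ->
  forall x y, b x y = - b y x.
Proof.
move=> bDl bDr bb x y; have := bb (x + y).
by rewrite bDl !bDr !bb add0r addr0 => /eqP; rewrite addr_eq0 => /eqP.
Qed.

Lemma mulr2n_eq0 (V : lmodType R) (v : V) : v *+ 2 = 0 -> v = 0.
Proof.
by rewrite -scaler_nat => /eqP; rewrite scaler_eq0 pnatr_eq0 => /eqP.
Qed.

Lemma derive_ext (V W : normedModType R) (f g : V -> W) x v :
  f =1 g -> 'D_v f x = 'D_v g x.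
Proof. by move=> /funext ->. Qed.

(** * Group identities *)

Section group.
Context {n : nat} (N : lieGroup R n).
Implicit Types a b c : N.

Lemma gmulr_inv a : gmul a (ginv a) = gone N.
Proof.
rewrite -[LHS]gmul1 -{1}(gmulV (ginv a)) -!gmulA [gmul (ginv a) _]gmulA gmulV.
by rewrite gmul1 gmulV.
Qed.

Lemma gmulr1 a : gmul a (gone N) = a.
Proof. by rewrite -(gmulV a) gmulA gmulr_inv gmul1. Qed.

Lemma gmulKg a b : gmul (ginv a) (gmul a b) = b.
Proof. by rewrite gmulA gmulV gmul1. Qed.

Lemma gmulgI a b c : gmul a b = gmul a c -> b = c.
Proof. by move=> e; rewrite -(gmulKg a b) e gmulKg. Qed.

Lemma gmulgK a b : gmul (gmul b a) (ginv a) = b.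
Proof. by rewrite -gmulA gmulr_inv gmulr1. Qed.

Lemma gmulIg a b c : gmul b a = gmul c a -> b = c.
Proof. by move=> e; rewrite -(gmulgK a b) e gmulgK. Qed.

Lemma gmul_idem a : gmul a a = a -> a = gone N.
Proof. by move=> e; apply: (@gmulgI a); rewrite e gmulr1. Qed.
End group.

Section exponential.
Context {n : nat} {N : lieGroup R n} {br : 'rV[R]_n -> 'rV[R]_n -> 'rV[R]_n}.
Context {exp : 'rV[R]_n -> N} {log : N -> 'rV[R]_n}.
Hypothesis hn : lie_algebra_of br exp log.
Local Notation mul a w := (log (gmul (exp a) (exp w))).

Let expD s t x : exp ((s + t) *: x) = gmul (exp (s *: x)) (exp (t *: x)).
Proof. by case: hn. Qed.
Let expK : cancel exp log.
Proof. by case: hn => _ _ []. Qed.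
Let logK : cancel log exp.
Proof. by case: hn => _ _ []. Qed.

Lemma exp0 : exp 0 = gone N.
Proof. by apply: gmul_idem; rewrite -[in RHS](scale0r 0) -[in RHS](addr0 0) expD !scale0r. Qed.

Lemma expN x : exp (- x) = ginv (exp x).
Proof.
apply: (@gmulIg _ _ (exp x)); rewrite gmulV.
by have := expD (-1) 1 x; rewrite addNr scale0r scaleN1r scale1r exp0.
Qed.

(** If [g s = exp c], then [g (k s) = exp (k c)] for natural [k]; so [homogeneous_curve] applies to
    [log \o g]. *)
Lemma one_parameter_subgroup (g : R -> N) :
  (forall s t, g (s + t) = gmul (g s) (g t)) -> differentiable (log \o g) 0 ->
  forall s, g s = exp (s *: 'D_1 (log \o g) 0).
Proof.
move=> gD dg s; rewrite -(homogeneous_curve dg) /= ?logK// => k {}s.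
elim: k => [|k IH].
  rewrite mul0r scale0r -(expK 0) exp0; congr log; apply: gmul_idem.
  by rewrite -gD addr0.
set c := log (g s) in IH *; rewrite -natr1 mulrDl mul1r gD.
have -> : g (k%:R * s) = exp (k%:R *: c) by rewrite -IH logK.
have -> : g s = exp (1 *: c) by rewrite scale1r logK.
by rewrite -expD expK.
Qed.

(** Near a given pair, the function is a composite of coordinate expressions: [H] for [exp] on both
    factors, [h] for the group law, [l] for [log]. [D], [E] and [F] are the successively smaller
    domains of the stages. *)
Lemma mul_smooth : smooth_on setT (fun p : 'rV[R]_n * 'rV[R]_n => mul p.1 p.2).
Proof.
have [_ _ [sexp slog _ _] _] := hn.
move=> k; apply: Ck_local => -[a w] _.
have [||phi1 [h1 [aphi1 r1]]] := @smooth_represents R n n (euclid R n) N exp (idparam R n) a sexp => //.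
have [||phi2 [h2 [aphi2 r2]]] := @smooth_represents R n n (euclid R n) N exp (idparam R n) w sexp => //.
have [_ p1 e1] := represents_at r1; have [_ p2 e2] := represents_at r2.
have [psi [y [apsi py ey]]] := chart_at (gmul (exp a) (exp w)).
have [|h [W [oW Wh sh hW]]] := gmul_smooth aphi1 aphi2 apsi p1 p2.
  by rewrite e1 e2 -ey; exists y.
have [_ _ pyh eyh] := hW _ Wh.
have [||_ [l [-> [U [oU Uy Upsi sl lU]]]]] :=
  @smooth_represents R n n N (euclid R n) log psi (h (h1 a, h2 w)) slog => //.
have [U1 [oU1 U1a _ sh1 hU1]] := r1.
have [U2 [oU2 U2w _ sh2 hU2]] := r2.
have cfst : continuous (fst : 'rV[R]_n * 'rV[R]_n -> 'rV[R]_n) by move=> ?; exact: cvg_fst.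
have csnd : continuous (snd : 'rV[R]_n * 'rV[R]_n -> 'rV[R]_n) by move=> ?; exact: cvg_snd.
pose D : set ('rV[R]_n * 'rV[R]_n) := fst @^-1` U1 `&` snd @^-1` U2.
have oD : open D.
  by apply: openI; apply: open_comp.
pose H (p : 'rV[R]_n * 'rV[R]_n) := (h1 p.1, h2 p.2).
have sH : smooth_on D H.
  apply: smooth_on_pair => //.
  - apply: (@smooth_on_comp _ _ _ _ _ U1 fst h1) => //; first exact: has_coordinates_rV.
      by move=> p [].
    exact: smooth_on_linear.
  - apply: (@smooth_on_comp _ _ _ _ _ U2 snd h2) => //; first exact: has_coordinates_rV.
      by move=> p [].
    exact: smooth_on_linear.
pose E := D `&` H @^-1` W.
have oE : open E := open_setI_preimage oD oW (fun p Dp => smooth_on_continuous sH Dp).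
have cVV := has_coordinates_prod (@has_coordinates_rV R n) (@has_coordinates_rV R n).
have sE : smooth_on E (h \o H).
  apply: (@smooth_on_comp _ _ _ _ _ W) => //; first by move=> p [].
  by move=> j; apply: Ck_sub (sH j) => p [].
pose F := E `&` (h \o H) @^-1` U.
have oF : open F := open_setI_preimage oE oU (fun p Ep => smooth_on_continuous sE Ep).
exists F; first by [].
apply: (@Ck_eq _ _ _ _ _ (l \o (h \o H))) => //.
  move=> p [[[U1p U2p] WHp] UHp] /=.
  have [_ <-] := hU1 _ U1p; have [_ <-] := hU2 _ U2p.
  by have [_ _ _ <-] := hW _ WHp; have [_] := lU _ UHp.
apply: (@smooth_on_comp _ _ _ _ _ U) => //.
- exact: has_coordinates_rV.
- by move=> p [].
- by move=> j; apply: Ck_sub (sE j) => p [].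
Qed.
Lemma mul_differentiable (V : normedModType R) (f g : V -> 'rV[R]_n) x :
  differentiable f x -> differentiable g x ->
  differentiable (fun t => mul (f t) (g t)) x.
Proof.
move=> df dg; have dfg := differentiable_pair df dg.
exact: (@differentiable_comp _ _ _ _ (fun t => (f t, g t)) _ x dfg
  (smooth_on_differentiable mul_smooth I)).
Qed.

Lemma mul0w w : mul 0 w = w.
Proof. by rewrite exp0 gmul1 expK. Qed.

Lemma mula0 a : mul a 0 = a.
Proof. by rewrite exp0 gmulr1 expK. Qed.

Lemma mulN a w : mul (- w) (- a) = - mul a w.
Proof.
apply: (can_inj expK); rewrite logK [RHS]expN logK !expN.
apply: (@gmulgI _ _ (gmul (exp a) (exp w))).
by rewrite gmulr_inv -gmulA [gmul (exp w) _]gmulA gmulr_inv gmul1 gmulr_inv.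
Qed.

(** * Left-invariant fields and the bracket *)

Local Notation L := (left_field exp log).

(** A partial derivative of a smooth function of two variables is differentiable in the base point
    too. *)
Lemma left_fieldE y a : L y a = 'D_(0, y) (fun p : 'rV[R]_n * 'rV[R]_n => mul p.1 p.2) (a, 0).
Proof.
have dp : is_diff (0 : 'rV[R]_n) (fun w : 'rV[R]_n => (a, w)) (fun w => (0 : 'rV[R]_n, w)).
  exact: (@is_diff_pair _ _ _ _ (cst a) 0 id id).
have dm := smooth_on_differentiable mul_smooth (I : setT (a, 0 : 'rV[R]_n)).
have := derive_comp y (ex_diff (is_diff_def := dp)) dm.
by rewrite (deriveE y (ex_diff (is_diff_def := dp))) diff_val.
Qed.

Lemma left_field_linear a s x y : L (s *: x + y) a = s *: L x a + L y a.
Proof.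
have dm : differentiable (fun w => mul a w) 0 by exact: mul_differentiable.
by rewrite /left_field !deriveE// linearP.
Qed.

Lemma left_field_sum a x : L x a = \sum_i x 0 i *: L (delta_mx 0 i) a.
Proof.
have dm : differentiable (fun w => mul a w) 0 by exact: mul_differentiable.
rewrite /left_field deriveE// {1}(row_sum_delta x) linear_sum.
by apply: eq_bigr => i _; rewrite linearZ deriveE.
Qed.

Lemma left_field_differentiable y a : differentiable (L y) a.
Proof.
rewrite (_ : L y = 'D_(0, y) (fun p : 'rV[R]_n * 'rV[R]_n => mul p.1 p.2) \o (fun a => (a, 0))); last first.
  by apply/funext => ?; exact: left_fieldE.
apply: differentiable_comp; first exact: differentiable_pair.
(* Order 2, since [L y] is already a first derivative. *)
have [_ /(_ (0, y)) Dm] := mul_smooth 2%N.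
by have [dDm _] := Dm; exact: dDm.
Qed.

Lemma left_field0 y : L y 0 = y.
Proof.
rewrite /left_field (_ : (fun w => _) = id) ?derive_id//.
by apply/funext => w; exact: mul0w.
Qed.

(** Both factors lie on the one-parameter subgroup of [y], where [mul] is addition. *)
Lemma left_field_line y s : L y (s *: y) = y.
Proof.
rewrite /left_field derive_line; last exact: mul_differentiable.
rewrite (_ : (fun t => _) = (fun t : R => s *: y + t *: y)).
  have dl := is_diffD (is_diff_cst (s *: y) (0 : R)) (is_diff_scalel (0 : R) y).
  by rewrite deriveE ?diff_val ?add0r ?[LHS]scale1r//; case: dl.
by apply/funext => t; rewrite -expD expK scalerDl.
Qed.

(* [L y] is constant on the line through [y], so [B] is alternating and is half
   of the bracket. *)
Local Notation B x y := ('D_x (L y) 0).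

Lemma bracket_alternating y : B y y = 0.
Proof.
rewrite derive_line; last exact: left_field_differentiable.
rewrite (_ : (fun t => _) = cst y) ?derive_cst//.
by apply/funext => t; exact: left_field_line.
Qed.

Lemma bracketDr u x y s : B u (s *: x + y) = s *: B u x + B u y.
Proof.
have -> : L (s *: x + y) = s *: L x + L y by apply/funext => a; exact: left_field_linear.
have dL := left_field_differentiable.
by rewrite deriveD ?deriveZ//; apply: diff_derivable => //; exact: differentiableZ.
Qed.

Lemma bracketDl x y u s : B (s *: x + y) u = s *: B x u + B y u.
Proof. by rewrite !deriveE ?linearP//; exact: left_field_differentiable. Qed.

Lemma bracket_anti x y : B x y = - B y x.
Proof.
apply: (@alternating_anti _ _ (fun x y => B x y)) => [u v w|u v w|u].
- by have := bracketDl u v w 1; rewrite !scale1r.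
- by have := bracketDr u v w 1; rewrite !scale1r.
- exact: bracket_alternating.
Qed.

Lemma brE x y : br x y = B x y *+ 2.
Proof. by have [_ _ _ /(_ x y) ->] := hn; rewrite (bracket_anti y x) opprK. Qed.

Lemma centralP x : central br x <-> forall y, B y x = 0.
Proof.
split=> cx y; last by rewrite brE (bracket_anti x y) cx oppr0 mul0rn.
by apply: mulr2n_eq0; rewrite -brE -[RHS]oppr0 -(cx y) !brE (bracket_anti x y) mulNrn opprK.
Qed.

Lemma centralZ s x : central br x -> central br (s *: x).
Proof.
move=> /centralP cx; apply/centralP => y.
have := bracketDr y x 0 s; rewrite addr0 => ->.
rewrite (cx y) scaler0 add0r (_ : L 0 = cst 0) ?derive_cst//.
by apply/funext => a; rewrite /left_field derive0.
Qed.

(** * Conjugation and the center *)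

Lemma exp_conj y x t :
  gmul (gmul (exp y) (exp (t *: x))) (exp (- y)) =
  exp (t *: log (gmul (gmul (exp y) (exp x)) (exp (- y)))).
Proof.
(* The conjugates form a one-parameter subgroup, whose velocity is read off at [s = 1]. *)
pose g s := gmul (gmul (exp y) (exp (s *: x))) (exp (- y)).
have gD s s' : g (s + s') = gmul (g s) (g s').
  rewrite /g expD -!gmulA; congr gmul; congr gmul.
  by rewrite [in RHS]gmulA -(gmulA _ (exp y)) !gmulA !expN -!gmulA gmulKg.
have dg (s : R) : differentiable (log \o g) s.
  rewrite (_ : log \o g = fun t => mul (mul y (t *: x)) (- y)).
    by do 2! apply: mul_differentiable => //; have := is_diff_scalel s x.
  by apply/funext => r; rewrite /= logK.
have gE := one_parameter_subgroup gD (dg 0).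
have -> : log (gmul (gmul (exp y) (exp x)) (exp (- y))) = 'D_1 (log \o g) 0.
  by have := gE 1; rewrite /g !scale1r => ->; rewrite expK.
exact: gE.
Qed.

(** Inversion, which is negation in these coordinates, exchanges right and left translations. *)
Lemma right_fieldE x a : 'D_x (fun w => mul w a) 0 = L x (- a).
Proof.
rewrite derive_line; last exact: mul_differentiable.
have dm (b : 'rV[R]_n) : differentiable (fun w => mul b w) 0 by exact: mul_differentiable.
rewrite (_ : (fun t => _) = - (fun t : R => mul (- a) (t *: - x))); last first.
  by apply/funext => t; rewrite -[RHS]/(- mul (- a) (t *: - x)) scalerN mulN opprK.
rewrite deriveN.
  by rewrite -(derive_line (- x) (dm (- a))) /left_field !deriveE// linearN opprK.
by apply: diff_derivable; exact: mul_differentiable.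
Qed.

(** By [exp_conj], every [exp (t *: x)] is central as well, so left and right translations agree
    along [x]. With [right_fieldE] this makes [L x] an even function, whose derivative at 0
    vanishes. *)
Lemma central_of_center x : Defs.center (exp x) -> central br x.
Proof.
move=> cx; apply/centralP => y.
have comm z t : gmul (exp z) (exp (t *: x)) = gmul (exp (t *: x)) (exp z).
  have := exp_conj z x t.
  have -> : gmul (gmul (exp z) (exp x)) (exp (- z)) = exp x by rewrite -cx expN gmulgK.
  by rewrite expK => e; rewrite -[in RHS]e expN -!gmulA gmulV gmulr1.
have Lx a : L x (- a) = L x a.
  rewrite -right_fieldE /left_field derive_line; last exact: mul_differentiable.
  rewrite [RHS]derive_line; last exact: mul_differentiable.
  by apply: derive_ext => t; rewrite comm.
have dL : differentiable (L x) 0 by exact: left_field_differentiable.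
have : B y x = - B y x.
  rewrite {1}derive_line// (_ : (fun t => _) = (fun t : R => L x (t *: - y))).
    by rewrite -derive_line// !deriveE// linearN.
  by apply/funext => t; rewrite scalerN Lx.
by move/eqP; rewrite -addr_eq0 -mulr2n => /eqP; exact: mulr2n_eq0.
Qed.

Lemma exp_central_comm x y : central br x ->
  gmul (exp y) (exp x) = gmul (exp x) (exp y).
Proof.
(* [A t = Ad (exp (t y)) x] has derivative [br y x = 0] at 0, hence everywhere. *)
move=> /centralP cx.
pose C z u := log (gmul (gmul (exp z) (exp u)) (exp (- z))).
have dC z u : differentiable (C z) u.
  rewrite (_ : C z = fun w => mul (mul z w) (- z)).
    by do 2! apply: mul_differentiable => //.
  by apply/funext => r; rewrite /C logK.
pose A (t : R) := C (t *: y) x.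
have dl (t : R) : differentiable (fun t : R => t *: y) t by have := is_diff_scalel t y.
have dA t : differentiable A t.
  rewrite (_ : A = fun t => mul (mul (t *: y) x) (- (t *: y))).
    apply: mul_differentiable; first exact: mul_differentiable.
    exact: differentiableN.
  by apply/funext => r; rewrite /A /C logK.
have A0 : A 0 = x by rewrite /A /C scale0r oppr0 exp0 gmulr1 gmul1 expK.
(* Conjugation by a product is a composite of conjugations; this will transport the derivative of
   [A] from 0 to any [t]. *)
have AD t h : A (t + h) = C (t *: y) (A h).
  have eN : - ((t + h) *: y) = ((- h) + (- t)) *: y by rewrite -scaleNr opprD addrC.
  by rewrite /A /C logK eN !expD !scaleNr !gmulA.
(* Since [exp (t *: y) exp (s *: x) = exp (s *: A t) exp (t *: y)], the left field of [x] at
   [t *: y] is the right field of [A t] there. *)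
have key t : L x (t *: y) = L (A t) (- (t *: y)).
  rewrite -right_fieldE derive_line; last exact: mul_differentiable.
  rewrite [LHS]derive_line; last exact: mul_differentiable.
  apply: derive_ext => s; congr log.
  by rewrite /A /C -exp_conj expN -gmulA gmulV gmulr1.
have A'0 : 'D_1 A 0 = 0.
  (* [u 0 = 0], so only the derivative of [u] contributes to that of [h i]. *)
  pose u t : 'rV[R]_n := A t - x.
  have du t : differentiable u t by apply: differentiableB.
  have Du : 'D_1 A 0 = 'D_1 u 0.
    by rewrite /u deriveB ?derive_cst ?subr0//; exact: diff_derivable.
  pose h (i : 'I_n) t := u t 0 i *: L (delta_mx 0 i) (- (t *: y)).
  have dh i : is_diff (0:R) (h i)
      (fun v => u 0 0 i *: 'd (fun t : R => L (delta_mx 0 i) (- (t *: y))) 0 v +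
                'd (fun t => u t 0 i) 0 v *: L (delta_mx 0 i) (- (0 *: y))).
    apply: is_diff_scale.
      exact: (@differentiable_comp _ _ _ _ u (fun w : 'rV[R]_n => w 0 i) 0 (du 0) (differentiable_coord _ _ _)).
    apply: (@differentiable_comp _ _ _ _ (fun t : R => - (t *: y)) (L (delta_mx 0 i))).
      exact: differentiableN.
    exact: left_field_differentiable.
  have sumh : 'D_1 (\sum_i h i) 0 = 'D_1 u 0.
    rewrite derive_sum => [|i]; last by apply: diff_derivable; have := dh i.
    rewrite [RHS]row_sum_delta; apply: eq_bigr => i _; have ? := dh i.
    rewrite deriveE// diff_val scale0r oppr0 left_field0 /u A0 subrr mxE scale0r add0r.
    congr (_ *: _); rewrite derive_mx; last exact: diff_derivable.
    rewrite mxE deriveE//.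
    exact: (@differentiable_comp _ _ _ _ u (fun w : 'rV[R]_n => w 0 i) 0 (du 0) (differentiable_coord _ _ _)).
  rewrite Du -sumh.
  (* The sum is [L (A t - x)] at [- (t *: y)], which [key] turns into a difference of values of
     [L x]; both terms have derivative 0 at 0 because [x] is central. *)
  have -> : \sum_i h i = (fun t => L x (t *: y)) - (fun t => L x (t *: - y)).
    apply/funext => t; rewrite fct_sumE /h -left_field_sum.
    rewrite [RHS]/(L x (t *: y) - L x (t *: - y)).
    by have := left_field_linear (- (t *: y)) (-1) x (A t);
      rewrite scalerN scaleN1r key addrC => ->; rewrite scaleN1r addrC.
  have dLx := left_field_differentiable x 0.
  have dLl z : derivable (fun t : R => L x (t *: z)) 0 1.
    apply: diff_derivable.
    apply: (@differentiable_comp _ _ _ _ (fun t : R => t *: z) (L x)).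
      by have := is_diff_scalel (0 : R) z.
    exact: left_field_differentiable.
  by rewrite deriveB// -!derive_line// !cx subrr.
have A' t : is_derive t (1 : R) A 0.
  apply: DeriveDef; first exact: diff_derivable.
  have dsh : is_diff t (fun r : R => r - t) id.
    by have := is_diffB (is_diff_id t) (is_diff_cst t t); rewrite subr0.
  have -> : A = (C (t *: y) \o A) \o (fun r => r - t).
    by apply/funext => r /=; rewrite -AD addrC subrK.
  have dCA r : differentiable (C (t *: y) \o A) r by exact: differentiable_comp.
  rewrite derive_comp// (deriveE (f := fun r : R => r - t))// diff_val subrr.
  by rewrite derive_comp// A'0 derive0.
have := derive0_cst A' 1; rewrite A0 => /(congr1 exp).
rewrite /A /C scale1r logK expN => e.
by rewrite -[LHS](gmulr1) -(gmulV (exp y)) [in LHS]gmulA e.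
Qed.

Lemma centerP x : Defs.center (exp x) <-> central br x.
Proof.
split=> [|cx a]; first exact: central_of_center.
by rewrite -(logK a) (exp_central_comm (log a) cx).
Qed.

(** Centrality of [x] makes [exp (t *: x) exp (t *: y)] a one-parameter subgroup, and its velocity
    is [x + y]. *)
Lemma exp_centralD x y : central br x -> exp (x + y) = gmul (exp x) (exp y).
Proof.
move=> cx; pose g t := gmul (exp (t *: x)) (exp (t *: y)).
have gD s t : g (s + t) = gmul (g s) (g t).
  rewrite /g !expD -!gmulA; congr gmul; rewrite !gmulA; congr gmul.
  exact/esym/exp_central_comm/centralZ.
have dl (z : 'rV[R]_n) : is_diff (0 : R) (fun t : R => t *: z) ( *:%R^~ z).
  exact: is_diff_scalel.
have dg : differentiable (log \o g) 0 by exact: mul_differentiable.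
suff D : 'D_1 (log \o g) 0 = x + y.
  by have := one_parameter_subgroup gD dg 1; rewrite D /g !scale1r => <-.
pose m (p : 'rV[R]_n * 'rV[R]_n) := mul p.1 p.2.
have dm p : differentiable m p by exact: smooth_on_differentiable mul_smooth I.
have dp := is_diff_pair (dl x) (dl y).
have -> : log \o g = m \o (fun t : R => (t *: x, t *: y)) by [].
rewrite derive_comp// (deriveE (f := fun t : R => (t *: x, t *: y)))// diff_val.
rewrite !scale0r !scale1r deriveE//.
(* The differential of [m] at the origin splits into its two partial ones, each the identity because
   0 is neutral on either side. *)
have -> : (x, y) = (x, 0) + (0, y) by rewrite [RHS]surjective_pairing/= addr0 add0r.
rewrite linearD -!deriveE// -left_fieldE left_field0; congr (_ + _).
have dx : is_diff (0 : 'rV[R]_n) (fun w : 'rV[R]_n => (w, 0 : 'rV[R]_n)) (fun w => (w, 0 : 'rV[R]_n)).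
  exact: (@is_diff_pair _ _ _ _ id id (cst 0) 0).
have := derive_comp x (ex_diff (is_diff_def := dx)) (dm (0, 0)).
rewrite (deriveE x (ex_diff (is_diff_def := dx))) diff_val => <-.
rewrite (_ : m \o _ = id) ?derive_id//.
by apply/funext => w; exact: mula0.
Qed.
End exponential.
End lie.

(** * The Witt decomposition *)

Section witt_decomposition.
Context {R : realType} {n : nat} {G : 'M[R]_n}.
Hypothesis Gsym : G^T = G.
Implicit Types x y u v : 'rV[R]_n.
Local Notation b x y := (x *m G *m y^T).

Let bC0 x y : b x y = 0 -> b y x = 0.
Proof. by move=> xy; apply: trmx_inj; rewrite trmx0 !trmx_mul trmxK Gsym mulmxA. Qed.

Lemma sub_perpP k (W : 'M[R]_(k, n)) x :
  reflect (forall y, (y <= W)%MS -> b x y = 0) (x <= perp G W)%MS.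
Proof.
rewrite /perp sub_kermx mulmxA; apply: (iffP eqP) => [xW y /submxP[s ->]|xW].
  by rewrite trmx_mul mulmxA xW mul0mx.
apply/trmx_inj/row_matrixP => i; rewrite trmx0 row0 trmx_mul trmxK row_mul.
by have := xW (row i W) (row_sub i W) => /(congr1 trmx); rewrite trmx_mul trmxK trmx0.
Qed.

Lemma perp_form0 k (W : 'M[R]_(k, n)) x y :
  (x <= perp G W)%MS -> (y <= W)%MS -> b x y = 0.
Proof. by move=> /sub_perpP xW; exact: xW. Qed.

(** Being the kernel of a matrix of rank at most [\rank W], [perp G W] has rank at least
    [n - \rank W]; with trivial intersection the ranks add up to [n]. *)
Lemma perp_span k (W : 'M[R]_(k, n)) : (W :&: perp G W = 0)%MS ->
  (1%:M <= W + perp G W)%MS.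
Proof.
move=> W0; rewrite sub1mx -col_leq_rank mxrank_disjoint_sum// /perp mxrank_ker.
have : (\rank (G *m W^T) <= \rank W)%N by rewrite -(mxrank_tr W) mxrankM_maxr.
have := rank_leq_row (G *m W^T).
by lia.
Qed.

(** Two orthogonal splittings: the whole space is [U + V + P], and [P] is spanned by [Z] and its
    orthocomplement in [P]. Then [U] and [Z] go to the center, [V] and [Epart] to the complement. *)
Lemma witt_span m (z : 'M[R]_(m, n)) (V : 'M[R]_n) :
  witt_complement G z V -> (1%:M <= z + vpart G z V)%MS.
Proof.
move=> [VV UV VU].
set U := Upart G z in UV VU; set P := UVperp G z V; set Z := Zpart G z V.
have Uz u : (u <= U)%MS -> (u <= z)%MS by rewrite /U /Upart sub_capmx => /andP[].
have Uperp u : (u <= U)%MS -> (u <= perp G z)%MS by rewrite /U /Upart sub_capmx => /andP[].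
have PU (p : 'rV[R]_n) : (p <= P)%MS -> (p <= perp G U)%MS by rewrite /P /UVperp sub_capmx => /andP[].
have PV (p : 'rV[R]_n) : (p <= P)%MS -> (p <= perp G V)%MS by rewrite /P /UVperp sub_capmx => /andP[].
have cap0 (A B : 'M[R]_n) x : (A :&: B = 0)%MS -> (x <= A)%MS -> (x <= B)%MS -> x = 0.
  by move=> AB xA xB; apply/eqP; rewrite -submx0 -AB sub_capmx xA.
have VperpU v : (v <= V)%MS -> (v <= perp G U)%MS -> v = 0 by exact: cap0.
have dec x : exists u v p, [/\ (u <= U)%MS, (v <= V)%MS, (p <= P)%MS & x = u + v + p].
  (* For [y] in the intersection, pairing with [U] kills the [V] component, as [U] is null; pairing
     with [V] then kills the rest. *)
  have W0 : ((U + V) :&: perp G (U + V)%MS = 0)%MS.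
    apply/eqP/rowV0P => y; rewrite sub_capmx => /andP[/sub_addsmxP[[s t] /= yE] /sub_perpP yW].
    have uU : (s *m U <= U)%MS by exact: submxMl.
    have vV : (t *m V <= V)%MS by exact: submxMl.
    have v0 : t *m V = 0.
      apply: VperpU => //; apply/sub_perpP => u' u'U.
      have := yW u' (submx_trans u'U (addsmxSl _ _)); rewrite yE !mulmxDl.
      by rewrite (perp_form0 (Uperp _ uU) (Uz _ u'U)) add0r.
    rewrite yE v0 addr0; apply: (cap0 _ _ _ UV) => //; apply/sub_perpP => v' v'V.
    by have := yW v' (submx_trans v'V (addsmxSr _ _)); rewrite yE v0 addr0.
  have : (x <= U + V + perp G (U + V)%MS)%MS by apply: submx_trans (perp_span W0); exact: submx1.
  move=> /sub_addsmxP[[s t] /= ->].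
  have : (s *m (U + V)%MS <= U + V)%MS by exact: submxMl.
  move=> /sub_addsmxP[[s' t'] /= ->].
  exists (s' *m U), (t' *m V), (t *m perp G (U + V)%MS); split=> //; rewrite ?submxMl//.
  rewrite /P /UVperp sub_capmx.
  have /sub_perpP pW : (t *m perp G (U + V)%MS <= perp G (U + V)%MS)%MS by exact: submxMl.
  by apply/andP; split; apply/sub_perpP => y yW; apply: pW; apply: (submx_trans yW);
    [exact: addsmxSl|exact: addsmxSr].
(* A central vector is orthogonal to [U], so it has no [V] component. *)
have decz y : (y <= z)%MS -> exists2 u, (u <= U)%MS & (y - u <= Z)%MS.
  move=> yz; have [u [v [p [uU vV pP yE]]]] := dec y.
  have v0 : v = 0.
    apply: VperpU => //; apply/sub_perpP => u' u'U.
    have := bC0 (perp_form0 (Uperp _ u'U) yz).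
    rewrite yE !mulmxDl (perp_form0 (Uperp _ uU) (Uz _ u'U)) add0r.
    by rewrite (perp_form0 (PU _ pP) u'U) addr0.
  have yu : y - u = p by rewrite yE v0 addr0 addrC addKr.
  exists u => //; rewrite /Z /Zpart sub_capmx {2}yu [(p <= _)%MS]pP andbT.
  by rewrite addmx_sub// eqmx_opp Uz.
(* By [decz], a vector of [Z] orthogonal to [Z] is orthogonal to the whole center, hence in [U]; it
   is orthogonal to [V] too. *)
have Z0 : (Z :&: perp G Z = 0)%MS.
  apply/eqP/rowV0P => x; rewrite sub_capmx => /andP[].
  rewrite {1}/Z /Zpart sub_capmx => /andP[xz xP] /sub_perpP xZ.
  apply: (cap0 _ _ _ UV); last exact: PV.
  rewrite /U /Upart sub_capmx xz; apply/sub_perpP => y /decz[u uU yuZ].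
  have := xZ _ yuZ; rewrite linearB/= mulmxBr.
  by rewrite (perp_form0 (PU _ xP) uU) subr0.
apply/row_subP => i; have [u [v [p [uU vV pP ->]]]] := dec (row i 1%:M).
have : (p <= Z + perp G Z)%MS by apply: submx_trans (perp_span Z0); exact: submx1.
move=> /sub_addsmxP[[s t] /= pE].
have ZZ : (s *m Z <= Z)%MS by exact: submxMl.
have /andP[Zz ZP] : (s *m Z <= z)%MS && (s *m Z <= P)%MS by rewrite -sub_capmx.
have EE : (t *m perp G Z <= Epart G z V)%MS.
  rewrite /Epart sub_capmx submxMl/=.
  have -> : t *m perp G Z = p - s *m Z by rewrite pE addrC addKr.
  by rewrite addmx_sub// eqmx_opp.
rewrite pE addrACA; apply: addmx_sub_adds.
  by rewrite addmx_sub// Uz.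
by rewrite /vpart; exact: addmx_sub_adds.
Qed.
End witt_decomposition.

(** * The fibers *)

Section fibers.
Context {R : realType}.

Lemma form_tr n (A : 'M[R]_n) u v : Defs.form A u v = Defs.form A^T v u.
Proof. by rewrite /Defs.form -[in LHS](trmxK (u *m A *m v^T)) mxE !trmx_mul trmxK mulmxA. Qed.

Lemma form_inj n (A A' : 'M[R]_n) : (forall u v, Defs.form A u v = Defs.form A' u v) -> A = A'.
Proof.
move=> AA'; apply/matrixP => i j; have := AA' (delta_mx 0 i) (delta_mx 0 j).
by rewrite /Defs.form -!rowE !trmx_delta -!colE !mxE.
Qed.

Lemma form_mulmx m n (z : 'M[R]_(m, n)) (A : 'M[R]_n) u v :
  Defs.form A (u *m z) (v *m z) = Defs.form (z *m A *m z^T) u v.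
Proof. by rewrite /Defs.form trmx_mul !mulmxA. Qed.

Lemma smooth_mulmx m n (z : 'M[R]_(m, n)) (c : 'rV[R]_m) :
  smooth_on setT (fun s : 'rV[R]_m => (s - c) *m z).
Proof.
have cl := @continuous_linear_rV R m _ (mulmxr z).
have -> : (fun s : 'rV[R]_m => (s - c) *m z) = (mulmxr z : 'rV[R]_m -> 'rV[R]_n) + cst (- (c *m z)).
  by apply/funext => s; rewrite mulmxBl.
move=> k; apply: CkD; [exact: openT|exact: smooth_on_linear (openT) cl k|exact: smooth_on_cst].
Qed.

Lemma derive_mulmx m n (z : 'M[R]_(m, n)) (c w x : 'rV[R]_m) :
  'D_w (fun s : 'rV[R]_m => (s - c) *m z) x = w *m z.
Proof.
have cl := @continuous_linear_rV R m _ (mulmxr z).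
have dl y : differentiable (mulmxr z : 'rV[R]_m -> 'rV[R]_n) y by exact: linear_differentiable.
have -> : (fun s : 'rV[R]_m => (s - c) *m z) = (mulmxr z : 'rV[R]_m -> 'rV[R]_n) + cst (- (c *m z)).
  by apply/funext => s; rewrite mulmxBl.
rewrite deriveD ?derive_cst ?addr0; [|exact: diff_derivable|exact: derivable_cst].
by rewrite deriveE// diff_lin.
Qed.

Context {n : nat} {N : lieGroup R n} {br : 'rV[R]_n -> 'rV[R]_n -> 'rV[R]_n}.
Context {exp : 'rV[R]_n -> N} {log : N -> 'rV[R]_n}.
Hypothesis hn : lie_algebra_of br exp log.
Context {Gam : set N} {M : manifold R n} {p : N -> M}.
Hypothesis hGam : lattice Gam p.
Context {G : 'M[R]_n} {gN : metric N} {gM : metric M}.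
Hypothesis hgNinv : left_invariant gN.
Hypothesis hG : value_at_one exp gN G.
Hypothesis hgM : preserves gN gM p.

(** * Exponential coordinates on the quotient *)

Local Notation E a := (fun t => p (gmul a (exp t))).

Let expK : cancel exp log.
Proof. by case: hn => _ _ []. Qed.
Let logK : cancel log exp.
Proof. by case: hn => _ _ []. Qed.
Let sexp : @smooth R n n (euclid R n) N exp.
Proof. by case: hn => _ _ []. Qed.
Let slog : @smooth R n n N (euclid R n) log.
Proof. by case: hn => _ _ []. Qed.
Let lp : local_diffeo p.
Proof. by case: hGam => _ _ []. Qed.

Lemma orbit_map_local_diffeo a : @local_diffeo R n (euclid R n) M (E a).
Proof.
have lexp : @local_diffeo R n (euclid R n) N exp by exact: diffeo_local_diffeo slog _ _.
have lmul : local_diffeo (gmul a).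
  have K1 : cancel (gmul a) (gmul (ginv a)) by exact: gmulKg.
  have K2 : cancel (gmul (ginv a)) (gmul a) by move=> b; rewrite gmulA gmulr_inv gmul1.
  exact (diffeo_local_diffeo (@gmul_smooth_r _ _ N a) (@gmul_smooth_r _ _ N (ginv a)) K1 K2).
exact: (local_diffeo_comp (local_diffeo_comp lexp lmul) lp).
Qed.

(** The metric is followed through the three factors: [hG] for [exp] at 0, [hgNinv] for [gmul a],
    [hgM] for [p]. *)
Lemma orbit_map_metric a psi h : atlas psi ->
  represents (idparam R n) psi (E a) 0 h ->
  forall u v, Defs.form G u v = Defs.form (gM psi (h 0)) ('D_u h 0) ('D_v h 0).
Proof.
move=> apsi rh u v.
have [//|//|phi1 [h1 [a1 r1]]] := @smooth_represents R n n (euclid R n) N exp (idparam R n) 0 sexp.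
have [_ p1 e1] := represents_at r1.
have [phi2 [h2 [a2 r2]]] := smooth_represents (@gmul_smooth_r _ _ N a) a1 p1.
have [_ p2 e2] := represents_at r2.
have [_ ph eh] := represents_at rh.
have [||h3 r3] := local_diffeo_smooth lp a2 apsi p2 => //.
  by rewrite e2 e1; exists (h 0).
have r12 := represents_comp r1 r2; have r := represents_comp r12 r3.
have [-> D] := represents_derive apsi rh r.
have d1 := represents_differentiable r1; have d2 := represents_differentiable r2.
have d3 := represents_differentiable r3; have d12 := represents_differentiable r12.
rewrite !D !(derive_comp _ d12 d3) !(derive_comp _ d1 d2).
rewrite -(hgM a2 apsi p2 r3) -(hgNinv a1 a2 p1 r2).
exact: hG.
Qed.

Lemma value_at_one_sym : G^T = G.
Proof.
have [//|//|psi [h [apsi r]]] := @smooth_represents R n n (euclid R n) N exp (idparam R n) 0 sexp.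
have [_ ph _] := represents_at r.
apply: form_inj => u v; rewrite -form_tr !(hG apsi r) form_tr.
by rewrite (Defs.metric_sym gN apsi ph).
Qed.

Context {m : nat} {z : 'M[R]_(m, n)}.
Hypothesis hz : center_basis br z.

Lemma central_mulmx s : central br (s *m z).
Proof. by case: hz => _ /(_ (s *m z))[+ _]; apply; exact: submxMl. Qed.

Lemma exp_mulmxD s y : exp (s *m z + y) = gmul (exp (s *m z)) (exp y).
Proof. exact: (exp_centralD hn _ (central_mulmx s)). Qed.

Lemma exp_mulmx_comm s a : gmul (exp (s *m z)) a = gmul a (exp (s *m z)).
Proof. exact: ((centerP hn _).2 (central_mulmx s)). Qed.

(** Changes the base point, so that any point of an orbit becomes the origin of some [E b]. *)
Lemma orbit_map_shift a s y : E a (s *m z + y) = E (gmul a (exp (s *m z))) y.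
Proof. by rewrite /= exp_mulmxD gmulA. Qed.

Lemma orbit_map_same_orbit a s y : same_orbit p (E a y) (E a (s *m z + y)).
Proof.
exists (exp (s *m z)), (gmul a (exp y)); split=> //.
  by apply/(centerP hn); exact: central_mulmx.
by rewrite /= exp_mulmxD !gmulA exp_mulmx_comm.
Qed.

(** Central factors move past [a], so the element of [Gam] relating the two points can only be
    [exp ((t - s) *m z)]; its inverse has logarithm [(s - t) *m z]. *)
Lemma orbit_map_fiber a s t :
  E a (s *m z) = E a (t *m z) <-> (log @` Gam) ((s - t) *m z).
Proof.
have [[_ _ GamV] _ [_ _ pE] _] := hGam.
have st r : gmul (exp ((r - s) *m z)) (gmul a (exp (s *m z))) = gmul a (exp (r *m z)).
  by rewrite gmulA exp_mulmx_comm -gmulA -exp_mulmxD -mulmxDl subrK.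
split=> [/pE[c Gc e]|[c Gc e]].
  exists (ginv c); first exact: GamV.
  have -> : c = exp ((t - s) *m z).
    by apply: (@gmulIg _ _ _ (gmul a (exp (s *m z)))); rewrite -e st.
  by rewrite -(expN hn) expK -mulNmx opprB.
apply/pE; exists (ginv c); first exact: GamV.
by rewrite -(logK c) e -(expN hn) -mulNmx opprB st.
Qed.

Lemma center_mulmx c : Defs.center c -> exists s, c = exp (s *m z).
Proof.
rewrite -(logK c) => /(centerP hn) /(hz.2 _).2 /submxP[s ->].
by exists s.
Qed.
Let atlas_id k : @atlas R k (euclid R k) (idparam R k).
Proof. by []. Qed.

(** * Fibers of the submersion near a point *)

Context {V : 'M[R]_n}.
Hypothesis hV : witt_complement G z V.
Context {B : manifold R (\rank (vpart G z V))} {gB : metric B} {nB : connection B}.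
Context {pB : M -> B}.
Hypothesis hB : pseudoriemannian_submersion exp p pB br G (vpart G z V) (pi_v G z V) gM gB nB.

Lemma submersion_orbit_map a s y : pB (E a (s *m z + y)) = pB (E a y).
Proof. by have [_ _ pBE _ _] := hB; apply/esym/pBE; exact: orbit_map_same_orbit. Qed.

(** The derivative of [pB \o E a] at 0 is injective on [vpart G z V], so [isolated_fiber] applies to
    a coordinate expression. *)
Lemma submersion_isolated a :
  \forall v \near (0 : 'rV[R]_n), (v <= vpart G z V)%MS ->
    pB (E a v) = pB (E a 0) -> v = 0.
Proof.
have [spB _ _ isoB _] := hB.
have [psi [x [apsi px ex]]] := chart_at (E a 0).
have [||h rh] := local_diffeo_smooth (orbit_map_local_diffeo a) (atlas_id n) apsi (I : pdom (idparam R n) 0) => //.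
  by exists x.
have [_ ph eh] := represents_at rh.
have [chi [f [achi rf]]] := smooth_represents spB apsi ph.
have dh := represents_differentiable rh; have df := represents_differentiable rf.
have [injh _] := local_diffeo_derive (orbit_map_local_diffeo a) (atlas_id n) apsi rh.
have rc := represents_comp rh rf.
have iso : \forall v \near (0 : 'rV[R]_n), (v <= vpart G z V)%MS ->
    (f \o h) v = (f \o h) 0 -> v = 0.
  apply: isolated_fiber => [|v vV]; first exact: differentiable_comp.
  rewrite derive_comp// => D0; apply: injh => //.
  (* Lifts to the induced subspace are unique, and both ['D_v h 0] and 0 lift the zero vector. *)
  have [_ /(_ 0)[u [_ uniq]]] := isoB _ _ _ _ apsi achi ph rf.
  have <- := uniq _ (conj _ D0); last first.
    by exists a, h, v.
  apply: uniq; split; last exact: derive0.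
  by exists a, h, 0; split=> //; rewrite ?sub0mx ?derive0.
have [U [oU U0 _ _ cU]] := rc.
have near1 : \forall v \near (0 : 'rV[R]_n), U v by exact: open_nbhs_nbhs.
near=> v => vV pv; have Uv : U v by near: v.
have iv : (v <= vpart G z V)%MS -> (f \o h) v = (f \o h) 0 -> v = 0 by near: v.
apply: iv => //; have [_ _ inj _] := atlas_lparam achi.
have [? e] := cU v Uv; have [? e0] := cU 0 U0.
by apply: inj => //; rewrite e e0.
Unshelve. all: by end_near. Qed.

(** Each [y] splits as [y *m A *m z + y *m Pv], and [pB] sees only the second term. On the fiber, a
    small [y] therefore has [y *m Pv = 0], and the point is given by [w = y *m A]. *)
Lemma orbit_nbhs a (O : set 'rV[R]_m) : nbhs (0 : 'rV[R]_m) O ->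
  nbhs (E a 0) [set e | pB e = pB (E a 0) -> exists2 w, O w & e = E a (w *m z)].
Proof.
move=> nO.
have /sub_addsmxP[[A C] /= dec] := witt_span value_at_one_sym hV.
pose Pv := C *m vpart G z V.
have cmul k l (D : 'M[R]_(k, l)) (P : set 'rV[R]_l) : nbhs (0 : 'rV[R]_l) P ->
    nbhs (0 : 'rV[R]_k) [set y | P (y *m D)].
  move=> nP; have c : {for 0, continuous (fun y : 'rV[R]_k => y *m D)}.
    exact: (@continuous_linear_rV R k _ (mulmxr D)).
  by apply: (c P); rewrite mul0mx.
have nA : nbhs (0 : 'rV[R]_n) ([set y | O (y *m A)] `&` [set y | (y *m Pv <= vpart G z V)%MS ->
    pB (E a (y *m Pv)) = pB (E a 0) -> y *m Pv = 0]).
  apply: filterI; first exact: cmul.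
  exact: (cmul _ _ _ [set v | (v <= vpart G z V)%MS -> pB (E a v) = pB (E a 0) -> v = 0] (submersion_isolated a)).
move: nA; rewrite (nbhsE (0 : 'rV[R]_n)) => -[Y [oY Y0] YA].
apply: (@filterS _ _ _ (E a @` Y)).
  move=> _ [y /YA [Oy iso] <-] /=.
  have yE : y = y *m A *m z + y *m Pv by rewrite /Pv -!mulmxA -mulmxDr -dec mulmx1.
  rewrite {1}yE submersion_orbit_map => pv.
  exists (y *m A) => //; rewrite {1}yE iso ?addr0//.
  by rewrite /Pv mulmxA submxMl.
apply: open_nbhs_nbhs; split; last by exists 0.
exact: (local_diffeo_open (orbit_map_local_diffeo a) oY).
Qed.

(** * The map from the flat torus to a fiber *)

Context {T : manifold R m} {gT : metric T} {q : 'rV[R]_m -> T}.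
Hypothesis hT : flat_quotient z G (log @` Gam) gT q.

Let lq : @local_diffeo R m (euclid R m) T q.
Proof. by case: hT. Qed.
Let q_surj t : exists s, q s = t.
Proof. by have [/(_ t I)[s _ <-] _ _ _] := hT; exists s. Qed.

(** A preimage under [q] is picked by choice; [fiber_mapE] shows that every preimage gives the same
    value. *)
Definition fiber_map a (t : T) : M := E a (projT1 (cid (q_surj t)) *m z).

Lemma fiber_mapE a s : fiber_map a (q s) = E a (s *m z).
Proof.
apply/(orbit_map_fiber a); have [_ _ <- _] := hT.
exact: projT2 (cid (q_surj (q s))).
Qed.

Lemma fiber_map_inj a : injective (fiber_map a).
Proof.
move=> t t'; have [s <-] := q_surj t; have [s' <-] := q_surj t'.
by rewrite !fiber_mapE => /(orbit_map_fiber a) ?; have [_ _ -> _] := hT.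
Qed.

Lemma smooth_linear_orbit a : @smooth R m n (euclid R m) M (fun s => E a (s *m z)).
Proof.
apply: (@smooth_comp R m n n (euclid R m) (euclid R n) M (fun s => s *m z) (E a)).
  move=> _ _ -> -> x _ _ _; exists (fun s => s *m z).
  have := smooth_mulmx z 0; rewrite (_ : (fun s => _) = (fun s => s *m z)); last first.
    by apply/funext => s; rewrite subr0.
  exact: represents_smooth.
exact: (local_diffeo_smooth (orbit_map_local_diffeo a)).
Qed.

(** Locally this is the smooth map [s |-> E a (s *m z)] after a smooth local inverse [r] of [q]. *)
Lemma fiber_map_smooth a : smooth (fiber_map a).
Proof.
move=> phi psi aphi apsi x px _ psiy.
have [s0 e0] := q_surj (phi x).
have [U [r [oU Us0 sq [oqU sr rK]]]] := lq s0.
have sF := smooth_in_comp (fun _ _ => I) sr (smooth_linear_orbit (a:=a)).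
have eF s : U s -> E a (r (q s) *m z) = fiber_map a (q s) by move=> Us; rewrite rK// fiber_mapE.
have qUx : (q @` U) (phi x) by exists s0.
have [|h rh] := sF _ _ aphi apsi x px qUx.
  by rewrite -e0 /= eF// e0.
exists h; apply: represents_near rh.
have nqU : nbhs (phi x) (q @` U) by exact: open_nbhs_nbhs.
have nx : nbhs x (phi @^-1` (q @` U)) := chart_cvg aphi px nqU.
by apply: filterS nx => y [s Us /= <-]; rewrite eF.
Qed.

(* Charts of the torus are traded for the linear coordinates given by [q], and
   [fiber_map a] for an orbit map based at a translate of [a]. *)
Lemma fiber_map_tangent a phi psi x h : atlas phi -> atlas psi -> pdom phi x ->
  represents phi psi (fiber_map a) x h ->
  exists s0 b k e, [/\ represents (idparam R m) phi q s0 k /\ k s0 = x,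
    represents (idparam R n) psi (E b) 0 e /\ e 0 = h x,
    (forall u, exists w, 'D_w k s0 = u) &
    forall w, 'D_('D_w k s0) h x = 'D_(w *m z) e 0].
Proof.
move=> aphi apsi px rh.
have [s0 e0] := q_surj (phi x).
have [||k rk] := local_diffeo_smooth lq (atlas_id m) aphi (I : pdom (idparam R m) s0) => //.
  by exists x.
have [_ pk ek] := represents_at rk.
have [_ _ inj _] := atlas_lparam aphi.
have ks0 : k s0 = x by apply: inj => //; rewrite ek.
have [_ ph eh] := represents_at rh.
(* This base point moves the computation to the origin of [E b], where [orbit_map_metric] is
   stated. *)
pose b := gmul a (exp (s0 *m z)).
have bE s : E b ((s - s0) *m z) = fiber_map a (q s).
  rewrite fiber_mapE (_ : s *m z = s0 *m z + (s - s0) *m z).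
    exact/esym/orbit_map_shift.
  by rewrite mulmxBl addrCA subrr addr0.
have [||e re] := local_diffeo_smooth (orbit_map_local_diffeo b) (atlas_id n) apsi (I : pdom (idparam R n) 0) => //.
  by exists (h x) => //; rewrite eh -e0 -bE subrr mul0mx.
have rk' : represents phi psi (fiber_map a) (k s0) h by rewrite ks0.
have r1 := represents_comp rk rk'.
have rl := represents_smooth s0 (smooth_mulmx z s0).
have re' : represents (idparam R n) psi (E b) ((s0 - s0) *m z) e by rewrite subrr mul0mx.
have r2 := represents_comp rl re'.
have r3 : represents (idparam R m) psi (fiber_map a \o q) s0 (e \o (fun s => (s - s0) *m z)).
  have <- : E b \o (fun s => (s - s0) *m z) = fiber_map a \o q.
    by apply/funext => s; exact: bE.
  exact: r2.
(* Both composites represent [fiber_map a \o q] at [s0], so they have the same derivatives. *)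
have [hk Dhk] := represents_derive apsi r1 r3.
exists s0, b, k, e; split.
- by split.
- by split=> //; rewrite -ks0 [RHS]hk /= subrr mul0mx.
- exact: (local_diffeo_derive lq (atlas_id m) aphi rk).2.
- move=> w; have := Dhk w.
  rewrite (derive_comp w (represents_differentiable rk) (represents_differentiable rk')).
  rewrite (derive_comp w (represents_differentiable rl) (represents_differentiable re')).
  by rewrite derive_mulmx subrr mul0mx ks0.
Qed.

Lemma fiber_map_immersion a : immersion (fiber_map a).
Proof.
split; first exact: fiber_map_smooth.
move=> phi psi x h aphi apsi px rh u.
have [s0 [b [k [e [[rk ks0] [re ehx] surj D]]]]] := fiber_map_tangent aphi apsi px rh.
have [w <-] := surj u; rewrite D => De.
have [inje _] := local_diffeo_derive (orbit_map_local_diffeo b) (atlas_id n) apsi re.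
have wz : w *m z = 0 by exact: inje.
have -> : w = 0 by apply: (row_free_inj hz.1); rewrite wz mul0mx.
exact: derive0.
Qed.

(** Both sides become the scalar product [G] of [w *m z] and [w' *m z]: through [q] by [hT], through
    [E b] by [orbit_map_metric]. *)
Lemma fiber_map_preserves a : preserves gT gM (fiber_map a).
Proof.
move=> phi psi x h aphi apsi px rh u v.
have [s0 [b [k [e [[rk ks0] [re ehx] surj D]]]]] := fiber_map_tangent aphi apsi px rh.
have [w <-] := surj u; have [w' <-] := surj v.
rewrite !D -ehx -(orbit_map_metric apsi re) form_mulmx -ks0.
have [_ _ _ qmetric] := hT.
by rewrite -(qmetric (idparam R m) phi s0 k (atlas_id m) aphi I rk).
Qed.

Lemma fiber_map_range a : range (fiber_map a) = pB @^-1` [set pB (p a)].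
Proof.
have [[GamOne _ _] _ [_ _ pE] _] := hGam.
have [_ _ pBE _ _] := hB.
have p0 : E a 0 = p a by rewrite (exp0 hn) gmulr1.
apply/seteqP; split=> [_ [t _ <-]|e].
  have [s <-] := q_surj t; rewrite /= fiber_mapE -p0.
  by have := submersion_orbit_map a s 0; rewrite addr0.
move=> /= /esym/pBE[c [a' [cc pa' <-]]].
have [s cE] := center_mulmx cc.
(* Two lifts of the same point differ by some [g] in [Gam], which the central [c] commutes with. *)
have /pE[g Gg ->] : p a = p a' by [].
exists (q s) => //; rewrite fiber_mapE; apply/pE; exists g => //.
by rewrite -cE gmulA cc -gmulA -cc.
Qed.

(** Shifting the base point to [b] makes a given point of the image the origin of [E b];
    [orbit_nbhs] then says that all nearby points of the fiber come from [U]. *)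
Lemma fiber_map_open a (U : set T) : open U ->
  exists2 W : set M, open W & fiber_map a @` U = W `&` range (fiber_map a).
Proof.
move=> oU.
have H t : U t -> nbhs (fiber_map a t) [set e | range (fiber_map a) e -> (fiber_map a @` U) e].
  have [s <-] := q_surj t => Uqs.
  have cq : {for s, continuous q} by exact: (smooth_continuous (local_diffeo_smooth lq)).
  have nU : nbhs (0 : 'rV[R]_m) [set w | U (q (s + w))].
    have nqs : nbhs s (q @^-1` U) by apply: cq; exact: open_nbhs_nbhs.
    by have := nqs; rewrite -[nbhs s _]/(\near s, (q @^-1` U) s) nbhs0P.
  pose b := gmul a (exp (s *m z)).
  have bE w : E b (w *m z) = fiber_map a (q (s + w)).
    by rewrite fiber_mapE mulmxDl; exact/esym/orbit_map_shift.
  have b0 : E b 0 = fiber_map a (q s) by have := bE 0; rewrite mul0mx addr0.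
  have := orbit_nbhs b nU; rewrite b0; apply: filterS => e eb re.
  have pBr e' : range (fiber_map a) e' -> pB e' = pB (p a) by rewrite fiber_map_range.
  have [|w Uw ->] := eb; first by rewrite (pBr e re) pBr//; exists (q s).
  by exists (q (s + w)) => //; rewrite -bE.
(* By [H], each of these interiors contains the corresponding image point, and inside it the range
   meets only the image of [U]. *)
exists (\bigcup_(t in U) interior [set e | range (fiber_map a) e -> (fiber_map a @` U) e]).
  by apply: bigcup_open => t _; exact: open_interior.
apply/seteqP; split=> [_ [t Ut <-]|e [[t Ut /interior_subset He] re]]; last exact: He.
by split; [exists t => //; exact: H|exists t].
Qed.
End fibers.

End torus_fibers.

Theorem theorem4p10 (R : realType) (n : nat)
  (* N, its Lie algebra 'rV[R]_n with bracket br, exp and log *)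
  (N : lieGroup R n) (br : 'rV[R]_n -> 'rV[R]_n -> 'rV[R]_n)
  (exp : 'rV[R]_n -> N) (log : N -> 'rV[R]_n)
  (hN : simply_connected R N)
  (hn : lie_algebra_of br exp log)
  (h2 : two_step_nilpotent br)
  (* the lattice Gam and M = Gam \ N *)
  (Gam : set N) (M : manifold R n) (p : N -> M)
  (hGam : lattice Gam p)
  (* the left-invariant metric tensor, on N and on M *)
  (G : 'M[R]_n) (gN : metric N) (gM : metric M)
  (hgN : nondegenerate_metric gN) (hgNinv : left_invariant gN)
  (hG : value_at_one exp gN G)
  (hgM : preserves gN gM p)
  (* the center of the Lie algebra and its complement *)
  (m : nat) (z : 'M[R]_(m, n)) (hz : center_basis br z)
  (V : 'M[R]_n) (hV : witt_complement G z V)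
  (* the flat torus T = z / (log Gam :&: z) *)
  (T : manifold R m) (gT : metric T) (q : 'rV[R]_m -> T)
  (hT : flat_quotient z G (log @` Gam) gT q)
  (* the submersion pB : M -> B *)
  (B : manifold R (\rank (vpart G z V))) (gB : metric B) (nB : connection B)
  (pB : M -> B)
  (hB : pseudoriemannian_submersion exp p pB br G (vpart G z V) (pi_v G z V)
          gM gB nB) :
  forall b : B, isometric_to_submanifold gT gM (pB @^-1` [set b]).
Proof.
move=> b; have [_ pBs _ _ _] := hB; have [_ _ [ps _ _] _] := hGam.
(* Any lift [a] of a point over [b] serves as base point. *)
have [e _ <-] := pBs b I; have [a _ <-] := ps e I.
exists (fiber_map (exp := exp) (p := p) hT a); split; [split| |].
- exact: (fiber_map_immersion hn hGam hz).
- exact: (fiber_map_inj hn hGam hz).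
- exact: (fiber_map_open hn hGam hG hz hV hB).
- exact: (fiber_map_range hn hGam hz hB).
- exact: (fiber_map_preserves hn hGam hgNinv hG hgM hz).
Qed.
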